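(* Let $\Omega \subset \mathbb{C}^d$, $d \ge 1$, be a Kobayashi hyperbolic domain and let $U \subset \mathbb{C}^d$ be an open set such that $U \cap \partial\Omega \neq \emptyset$, $\#(U \cap \partial \Omega) > 1$, and $U \cap \Omega$ is connected. Suppose that every pair of distinct points of $U \cap \partial \Omega$ has the weak visibility property with respect to $(U \cap \Omega, \mathsf{k}_{U \cap \Omega})$. Then for all open sets $W, W_0 \subset \mathbb{C}^d$ with $W \cap \Omega \neq \emptyset$, $W \subset\subset W_0 \subset\subset U$ and $\mathsf{k}_{\Omega}(W_0 \cap \Omega, \Omega \setminus U) > 0$, there exists a constant $C > 0$, depending only on $U, W, W_0$, such that for all $z, w \in W \cap \Omega$, $$\mathsf{k}_{U \cap \Omega}(z, w) \le \mathsf{k}_{\Omega}(z, w) + C.$$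
   Context: For a domain $D \subset \mathbb{C}^d$, $\mathsf{k}_D$ is the Kobayashi pseudodistance and $\kappa_D(z;v)$ ($z\in D$, $v \in \mathbb{C}^d$) the Kobayashi--Royden pseudometric; $D$ is Kobayashi hyperbolic if $\mathsf{k}_D$ is a distance. For $X, Y \subset D$, $\mathsf{k}_D(X,Y) = \inf_{x \in X, y \in Y} \mathsf{k}_D(x,y)$ (with $\inf\emptyset = +\infty$). $X \subset\subset U$ means that $\overline{X}$ is compact and $\overline{X} \subset U$. $\partial$ denotes the boundary in $\mathbb{C}^d$; note that $U\cap\partial\Omega \subset \partial(U\cap\Omega)$. For $\kappa \ge 0$, a $(1,\kappa)$-almost-geodesic of $(D, \mathsf{k}_D)$ is an absolutely continuous curve $\gamma : I \to D$ on an interval $I \subset \mathbb{R}$ such that $|t-s| - \kappa \le \mathsf{k}_D(\gamma(s),\gamma(t)) \le |t-s| + \kappa$ for all $s,t \in I$ and $\kappa_D(\gamma(t);\gamma'(t)) \le 1$ for almost every $t \in I$. Weak visibility: for a Kobayashi hyperbolic domain $D$, a pair of distinct points $p, q \in \partial D$ has the weak visibility property with respect to $(D, \mathsf{k}_D)$ if for every $\kappa \ge 0$ there exist neighbourhoods $V_p$ of $p$ and $V_q$ of $q$ in $\mathbb{C}^d$ with $\overline{V_p} \cap \overline{V_q} = \emptyset$ and a compact set $K \subset D$ such that every $(1,\kappa)$-almost-geodesic $\gamma : [0,a] \to D$ of $(D,\mathsf{k}_D)$ with $\gamma(0) \in V_p \cap D$ and $\gamma(a) \in V_q \cap D$ satisfies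 $\gamma([0,a]) \cap K \neq \emptyset$. *)

(* Defs.v *)
From HB Require Import structures.
From mathcomp Require Import all_boot all_order all_algebra.
From mathcomp Require Import all_classical all_reals all_analysis.
From mathcomp Require Import complex.

Set Implicit Arguments.
Unset Strict Implicit.
Unset Printing Implicit Defensive.

Import Order.TTheory GRing.Theory Num.Theory.
Import numFieldNormedType.Exports.

Local Open Scope classical_set_scope.
Local Open Scope ring_scope.
Local Open Scope complex_scope.

(* MathComp-Analysis topologizes abstract numeric fields only; this gives the
   concrete field [R[i]] the same structure, so that ['rV[R[i]]_d], with its
   sup norm, is C^d. *)
HB.instance Definition _ (R : rcfType) := NormedModule.copy R[i] R[i]^o.

Definition frontier {T : topologicalType} (A : set T) : set T :=
  closure A `\` interior A.

Definition domain {T : topologicalType} (D : set T) : Prop :=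
  [/\ open D, connected D & D !=set0].

Definition relatively_compact_in {T : topologicalType} (X U : set T) : Prop :=
  compact (closure X) /\ closure X `<=` U.

Definition distance_on {R : realType} {T : Type} (D : set T)
    (k : T -> T -> \bar R) : Prop :=
  [/\ forall x y, D x -> D y -> k x y \is a fin_num /\ (0 <= k x y)%E,
      forall x y, D x -> D y -> (k x y = 0%E <-> x = y),
      forall x y, D x -> D y -> k x y = k y x
    & forall x y z, D x -> D y -> D z -> (k x z <= k x y + k y z)%E].

Definition set_distance {R : realType} {T : Type} (k : T -> T -> \bar R)
    (X Y : set T) : \bar R :=
  ereal_inf [set k x y | x in X & y in Y].

Section Kobayashi.
Context {R : realType} {d : nat}.
Implicit Types (D : set 'rV[R[i]]_d) (z w v p q : 'rV[R[i]]_d).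

Definition unit_disc : set R[i] := [set x | Normc.normc x < 1].

(* Only the values of [f] on the disc matter; since the scalar field of the
   source is [R[i]], [derivable f x 1] is complex differentiability. *)
Definition holomorphic_disc D (f : R[i] -> 'rV[R[i]]_d) : Prop :=
  forall x, unit_disc x -> derivable f x 1 /\ D (f x).

(* artanh of the Moebius distance (curvature -4), so that its infinitesimal
   form at 0 is |xi|, as in [kobayashi_metric]. *)
Definition poincare_distance (a b : R[i]) : R :=
  let m := Normc.normc ((a - b) / (1 - conjc b * a)) in
  2^-1 * ln ((1 + m) / (1 - m)).

(* Infimum over chains of [n.+1] analytic discs joining [z] to [w]. *)
Definition kobayashi_distance D z w : \bar R :=
  ereal_inf [set s | exists (n : nat) (f : nat -> R[i] -> 'rV[R[i]]_d)
      (a b : nat -> R[i]),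
    [/\ forall j, (j <= n)%N ->
          [/\ holomorphic_disc D (f j), unit_disc (a j) & unit_disc (b j)],
        f 0%N (a 0%N) = z,
        f n (b n) = w,
        forall j, (j < n)%N -> f j (b j) = f j.+1 (a j.+1)
      & s = (\sum_(j < n.+1) poincare_distance (a j) (b j))%:E]].

Definition kobayashi_metric D z v : \bar R :=
  ereal_inf [set (Normc.normc xi)%:E | xi in [set xi : R[i] |
    exists f, [/\ holomorphic_disc D f, f 0 = z & xi *: 'D_1 f 0 = v]]].

Definition kobayashi_hyperbolic D : Prop :=
  distance_on D (kobayashi_distance D).

Definition abs_continuous (I : interval R) (g : R -> 'rV[R[i]]_d) : Prop :=
  forall e : R, 0 < e -> exists2 r : R, 0 < r &
    forall (n : nat) (a b : 'I_n -> R),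
      (forall j, [/\ a j <= b j, a j \in I & b j \in I]) ->
      trivIset [set: 'I_n] (fun j => `]a j, b j[%classic) ->
      \sum_(j < n) (b j - a j) < r ->
      \sum_(j < n) `|g (b j) - g (a j)| < e%:C.

(* Derivative in the real variable [t]; ['rV[R[i]]_d] is a normed module over
   [R[i]] only, hence the explicit difference quotient. *)
Definition has_velocity (g : R -> 'rV[R[i]]_d) (t : R) v : Prop :=
  (h^-1)%:C *: (g (t + h) - g t) @[h --> (0 : R)^'] --> v.

(* [g] is a total function; only its restriction to [I] matters, the endpoints
   of [I] being Lebesgue-null. *)
Definition almost_geodesic (kappa : R) D (I : interval R)
    (g : R -> 'rV[R[i]]_d) : Prop :=
  [/\ forall t, t \in I -> D (g t),
      abs_continuous I g,
      forall s t, s \in I -> t \in I ->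
        ((`|t - s| - kappa)%:E <= kobayashi_distance D (g s) (g t))%E /\
        (kobayashi_distance D (g s) (g t) <= (`|t - s| + kappa)%:E)%E
    & {ae @lebesgue_measure R, forall t, t \in I ->
        exists2 v, has_velocity g t v & (kobayashi_metric D (g t) v <= 1)%E}].

(* Intended for [D] hyperbolic and [p], [q] distinct points of [frontier D]. *)
Definition weak_visibility D p q : Prop :=
  forall kappa : R, 0 <= kappa ->
  exists Vp Vq K : set 'rV[R[i]]_d,
    [/\ nbhs p Vp /\ nbhs q Vq,
        closure Vp `&` closure Vq = set0,
        compact K /\ K `<=` D
      & forall (a : R) (g : R -> 'rV[R[i]]_d), 0 <= a ->
          almost_geodesic kappa D `[0, a] g ->
          (Vp `&` D) (g 0) -> (Vq `&` D) (g a) ->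
          (g @` `[0, a]) `&` K !=set0].

End Kobayashi.

(* Main.v *)
Require Import Defs.
From HB Require Import structures.
From mathcomp Require Import all_boot all_order all_algebra.
From mathcomp Require Import all_classical all_reals all_analysis.
From mathcomp Require Import complex.
From mathcomp Require Import ring lra.

(** Write [D = U `&` Omega], and [kd] for Kobayashi distances. A chain of
    analytic discs in a domain gives a path, namely the hyperbolic geodesics
    of its discs run one after the other at unit speed, so distances are
    infima of lengths of such paths. The proof compares lengths in [Omega] and
    in [D] of one and the same path.

    Two facts drive the comparison. First, localization: at a point whose
    [Omega]-distance to the complement of [U] is at least [r], the part of a
    disc in [Omega] within hyperbolic distance [r] of its centre lands in [D].
    Rescaling it to a full disc shows that passing to [D] multiplies
    infinitesimal lengths by at most [coth r], exponentially close to 1. If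
    along a path [r] grows linearly with the time elapsed from some instant,
    the total excess of length is bounded by a constant
    ([kd_localize_path]). Secondly,
    visibility: an almost-optimal path in [D] is a [(1, kappa)]-almost-geodesic,
    hence two points of [D] close to distinct boundary points inside [U] are
    joined almost optimally through a fixed compact set
    ([visibility_bound]).

    Fix a base point [o] in [D]. An almost-optimal path in [Omega] from a
    point [z] to the complement of a neighbourhood [W'] recedes from the
    complement linearly when run backwards, so by localization its exit point
    is no further from [z] in [D] than in [Omega], up to a constant; by
    visibility it is at least as far from [z] in [D] as [o] is, up to a
    constant. Therefore [kd D z o <= kd Omega z y + C] for every [y] outside
    [W'] ([kd_exit_bound]).

    Now insert [W1] between [W] and [W0], and take an almost-optimal path in
    [Omega] from [z] to [w], both in [W]. If it leaves [W1] at some point [y],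
    the previous inequality for the pairs [(z, y)] and [(w, y)] bounds
    [kd D z o + kd D o w] by the length of the path plus a constant. If it
    stays in [W1], the previous inequality, applied at the points of the path
    with respect to [W0], shows that they are at least as far from the
    complement of [U] as from [o], up to a constant; and the distance to [o]
    of an almost-optimal path at time [t] is at least
    [|t - kd Omega z o| - 1]. So localization applies with [kd Omega z o] as
    the distinguished time.

    Visibility is about absolutely continuous curves, and analytic discs are
    only assumed complex differentiable at each point. The paths above are
    Lipschitz thanks to Cauchy estimates, and these are obtained from
    Goursat's lemma on rectangles: the difference quotient of [f] at a point
    has a removable singularity there, so its contour integral vanishes, which
    is Cauchy's formula ([cauchy_formula], [holomorphic_lipschitz]). *)

Set Implicit Arguments.
Unset Strict Implicit.
Unset Printing Implicit Defensive.

Import Order.TTheory GRing.Theory Num.Theory.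
Import numFieldNormedType.Exports.

Local Open Scope complex_scope.
Local Open Scope classical_set_scope.
Local Open Scope ring_scope.

Local Notation normc := Normc.normc.
Local Notation Re := complex.Re.
Local Notation Im := complex.Im.

(** * The complex plane with real-valued norms *)

Section ComplexPlane.
Context {R : realType}.
Implicit Types (x y z w : R[i]).

Lemma normE z : `|z| = (normc z)%:C.
Proof. by rewrite normc_def; case: z. Qed.

Lemma ltcR_norm z (e : R) : (`|z| < e%:C) = (normc z < e).
Proof. by rewrite normE ltcR. Qed.

Lemma gtc0E (e : R[i]) : 0 < e -> exists2 r : R, 0 < r & e = r%:C.
Proof.
case: e => a b; rewrite ltcE /= => /andP[/eqP -> a0].
by exists a.
Qed.

Lemma normc_real (t : R) : normc t%:C = `|t|.
Proof. by rewrite /= expr0n addr0 sqrtr_sqr. Qed.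

Lemma normc_ge0 z : 0 <= normc z.
Proof. by case: z => a b; rewrite /= sqrtr_ge0. Qed.

Lemma normc_Re z : `|Re z| <= normc z.
Proof. by have := normc_ge_Re z; rewrite normE lecR. Qed.

Lemma normc_Im z : `|Im z| <= normc z.
Proof.
case: z => a b /=; rewrite -(sqrtr_sqr b) ler_wsqrtr //.
by rewrite lerDr sqr_ge0.
Qed.

Lemma normc_le_ReIm z : normc z <= `|Re z| + `|Im z|.
Proof.
case: z => a b /=.
have h : a ^+ 2 + b ^+ 2 <= (`|a| + `|b|) ^+ 2.
  rewrite -(real_normK (num_real a)) -(real_normK (num_real b)).
  have := normr_ge0 a; have := normr_ge0 b; nra.
apply: (le_trans (ler_wsqrtr h)).
by rewrite sqrtr_sqr ger0_norm // addr_ge0.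
Qed.

(** Convergence in [R[i]] is quantified over positive elements of [R[i]], that
    is, over positive reals in disguise; this lemma and [nbhs_normcP] below
    trade them for genuine reals once and for all. *)
Lemma cvg_cplxP {T : Type} {F : set_system T} {FF : Filter F} (g : T -> R[i]) z :
  g @ F --> z <-> forall e : R, 0 < e -> \forall t \near F, normc (z - g t) < e.
Proof.
split=> [/cvgrPdist_lt h e e0|h].
  have e0' : 0 < e%:C :> R[i] by rewrite ltcR.
  by apply: filterS (h _ e0') => t; rewrite ltcR_norm.
apply/cvgrPdist_lt => e /gtc0E[r r0 ->].
by apply: filterS (h _ r0) => t; rewrite ltcR_norm.
Qed.

Lemma near_normc z (e : R) : 0 < e -> \forall t \near z, normc (z - t) < e.
Proof.
move=> e0; have e0' : 0 < e%:C :> R[i] by rewrite ltcR.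
have := @nbhsx_ballx R[i] R[i] z _ e0'.
by apply: (@filterS _ (nbhs z) _) => t; rewrite -ltcR_norm.
Qed.

Lemma continuous_Re : continuous (@Re R : R[i] -> R).
Proof.
move=> z; apply/(@cvgrPdist_lt _ _ _ (nbhs z) (nbhs_filter z)) => e e0.
have := near_normc z e0; apply: (@filterS _ (nbhs z) _) => t; apply: le_lt_trans.
by have := normc_Re (z - t); rewrite raddfB.
Qed.

Lemma continuous_Im : continuous (@Im R : R[i] -> R).
Proof.
move=> z; apply/(@cvgrPdist_lt _ _ _ (nbhs z) (nbhs_filter z)) => e e0.
have := near_normc z e0; apply: (@filterS _ (nbhs z) _) => t; apply: le_lt_trans.
by have := normc_Im (z - t); rewrite raddfB.
Qed.

End ComplexPlane.

(** * Integrals of complex functions over segments *)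

Section Integral.
Context {R : realType}.
Implicit Types (a b t e : R) (c z w : R[i]).
Local Notation mu := (@lebesgue_measure R).

(** The Lebesgue integral over a segment, used here on continuous functions
    only; a real integral on each component is all that the complex contour
    integrals need. *)
Definition seg_int a b (g : R -> R) : R := (\int[mu]_(t in `[a, b]) g t)%R.

Lemma seg_integrable a b (g : R -> R) : continuous g ->
  mu.-integrable `[a, b] (EFin \o g).
Proof.
move=> cg; apply: continuous_compact_integrable; first exact: segment_compact.
exact: continuous_subspaceT.
Qed.

Lemma seg_int_split a m b (g : R -> R) : continuous g -> a <= m -> m <= b ->
  seg_int a b g = seg_int a m g + seg_int m b g.
Proof.
move=> cg am mb; rewrite /seg_int.
have := @Rintegral_itvB R g (BLeft a) (BRight b) m (seg_integrable _ _ cg).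
rewrite !bnd_simp => /(_ am mb) h.
rewrite (@Rintegral_itv_obnd_cbnd R m (BRight b)) in h; last first.
  apply: integrableS (@seg_integrable m b _ cg) => //.
  by apply: subset_itvr; rewrite bnd_simp.
by rewrite -h addrC subrK.
Qed.

Lemma seg_int_lin a b (k : R) (g h : R -> R) : continuous g -> continuous h ->
  seg_int a b (fun t => k * g t + h t) = k * seg_int a b g + seg_int a b h.
Proof.
move=> cg ch; rewrite /seg_int RintegralD //; last exact: seg_integrable.
  by rewrite RintegralZl //; exact: seg_integrable.
apply: (@seg_integrable a b (fun t => k * g t)) => t.
by apply: cvgM; [exact: cvg_cst|exact: cg].
Qed.

Lemma seg_int_cst a b (k : R) : a <= b -> seg_int a b (fun=> k) = k * (b - a).
Proof.
move=> ab; rewrite /seg_int Rintegral_cst //= lebesgue_measure_itv /= lte_fin.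
move: ab; rewrite le_eqVlt => /predU1P[->|->] /=; last by [].
by rewrite ltxx subrr.
Qed.

Lemma seg_int_ge a b (k : R) (g : R -> R) : continuous g -> a <= b ->
  (forall t, a <= t <= b -> k <= g t) -> k * (b - a) <= seg_int a b g.
Proof.
move=> cg ab h; rewrite -seg_int_cst //; apply: le_Rintegral => //.
- by apply: (@seg_integrable a b (fun=> k)); exact: cst_continuous.
- exact: seg_integrable.
Qed.

Lemma seg_int_close a b (k e : R) (g : R -> R) : continuous g -> a <= b ->
  (forall t, a <= t <= b -> `|g t - k| <= e) ->
  `|seg_int a b g - (b - a) * k| <= e * (b - a).
Proof.
move=> cg ab h.
have -> : (b - a) * k = seg_int a b (fun=> k) by rewrite seg_int_cst // mulrC.
have -> : seg_int a b g - seg_int a b (fun=> k) = seg_int a b (fun t => g t - k).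
  rewrite /seg_int RintegralB //; first exact: seg_integrable.
  by apply: (@seg_integrable a b (fun=> k)); exact: cst_continuous.
have cgk : continuous (fun t => g t - k).
  by move=> t; apply: cvgB; [exact: cg|exact: cvg_cst].
apply: (le_trans (le_normr_Rintegral _ (seg_integrable _ _ cgk))) => //.
rewrite -seg_int_cst //; apply: le_Rintegral => //.
- apply: (@seg_integrable a b (fun t => `|g t - k|)) => t.
  by apply: (@cvg_norm _ _ _ _ _ (fun t => g t - k)); exact: cgk.
- by apply: (@seg_integrable a b (fun=> e)); exact: cst_continuous.
Qed.

Definition cseg_int a b (g : R -> R[i]) : R[i] :=
  seg_int a b (fun t => Re (g t)) +i* seg_int a b (fun t => Im (g t)).

Lemma continuous_Re_comp (g : R -> R[i]) : continuous g -> continuous (fun t => Re (g t)).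
Proof. by move=> cg t; apply: continuous_comp; [exact: cg|exact: continuous_Re]. Qed.

Lemma continuous_Im_comp (g : R -> R[i]) : continuous g -> continuous (fun t => Im (g t)).
Proof. by move=> cg t; apply: continuous_comp; [exact: cg|exact: continuous_Im]. Qed.

Lemma cseg_int_split a m b (g : R -> R[i]) : continuous g -> a <= m -> m <= b ->
  cseg_int a b g = cseg_int a m g + cseg_int m b g.
Proof.
move=> cg am mb; rewrite /cseg_int !(@seg_int_split a m b) //.
- exact: continuous_Im_comp.
- exact: continuous_Re_comp.
Qed.

Lemma cseg_int_lin a b c (g h : R -> R[i]) : continuous g -> continuous h ->
  cseg_int a b (fun t => c * g t + h t) = c * cseg_int a b g + cseg_int a b h.
Proof.
move=> cg ch; have rg := continuous_Re_comp cg; have ig := continuous_Im_comp cg.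
have rh := continuous_Re_comp ch; have ih := continuous_Im_comp ch.
case: c => p q; rewrite /cseg_int.
have clin (k : R) (u v : R -> R) : continuous u -> continuous v ->
    continuous (fun t => k * u t + v t).
  move=> cu cv t; apply: cvgD; last exact: cv.
  by apply: cvgM; [exact: cvg_cst|exact: cu].
have -> : (fun t => Re ((p +i* q) * g t + h t)) =
    (fun t => p * Re (g t) + ((- q) * Im (g t) + Re (h t))).
  by apply/funext => t /=; case: (g t) (h t) => [? ?] [? ?] /=; ring.
have -> : (fun t => Im ((p +i* q) * g t + h t)) =
    (fun t => p * Im (g t) + (q * Re (g t) + Im (h t))).
  by apply/funext => t /=; case: (g t) (h t) => [? ?] [? ?] /=; ring.
rewrite !(@seg_int_lin a b) //; try exact: clin.
by apply/eqP; rewrite eq_complex /=; apply/andP; split; apply/eqP; ring.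
Qed.

(** The factor 2 comes from estimating the real and imaginary parts
    separately. *)
Lemma cseg_int_close a b c e (g : R -> R[i]) : continuous g -> a <= b ->
  (forall t, a <= t <= b -> normc (g t - c) <= e) ->
  normc (cseg_int a b g - (b - a)%:C * c) <= 2 * e * (b - a).
Proof.
move=> cg ab h; apply: (le_trans (normc_le_ReIm _)).
have -> : 2 * e * (b - a) = e * (b - a) + e * (b - a) by ring.
apply: lerD.
- have -> : Re (cseg_int a b g - (b - a)%:C * c) =
      seg_int a b (fun t => Re (g t)) - (b - a) * Re c.
    by rewrite /cseg_int; case: (c) => ? ? /=; ring.
  apply: seg_int_close => // [|t /h]; first exact: continuous_Re_comp.
  by apply: le_trans; have := normc_Re (g t - c); rewrite raddfB.
- have -> : Im (cseg_int a b g - (b - a)%:C * c) =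
      seg_int a b (fun t => Im (g t)) - (b - a) * Im c.
    by rewrite /cseg_int; case: (c) => ? ? /=; ring.
  apply: seg_int_close => // [|t /h]; first exact: continuous_Im_comp.
  by apply: le_trans; have := normc_Im (g t - c); rewrite raddfB.
Qed.

End Integral.

(** * Goursat's lemma for rectangles *)

Section Goursat.
Context {R : realType}.
Implicit Types (a b t e : R) (c z w : R[i]) (f : R[i] -> R[i]).

Definition contour x0 x1 y0 y1 f : R[i] :=
  (cseg_int x0 x1 (fun x => f (x +i* y0)) - cseg_int x0 x1 (fun x => f (x +i* y1)))
  + 'i * (cseg_int y0 y1 (fun y => f (x1 +i* y))
          - cseg_int y0 y1 (fun y => f (x0 +i* y))).

Definition continuous_on_lines f :=
  (forall y, continuous (fun x => f (x +i* y))) /\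
  (forall x, continuous (fun y => f (x +i* y))).

Definition in_rect x0 x1 y0 y1 z := x0 <= Re z <= x1 /\ y0 <= Im z <= y1.

Lemma contour_split4 x0 xm x1 y0 ym y1 f : continuous_on_lines f ->
  x0 <= xm -> xm <= x1 -> y0 <= ym -> ym <= y1 ->
  contour x0 x1 y0 y1 f =
    (contour x0 xm y0 ym f + contour xm x1 y0 ym f)
    + (contour x0 xm ym y1 f + contour xm x1 ym y1 f).
Proof.
move=> [cx cy] x0m xm1 y0m ym1; rewrite /contour.
rewrite (cseg_int_split (cx y0) x0m xm1) (cseg_int_split (cx y1) x0m xm1).
rewrite (cseg_int_split (cy x0) y0m ym1) (cseg_int_split (cy x1) y0m ym1).
ring.
Qed.

(** The contour integral of an affine function vanishes because on opposite
    sides its values differ by a constant, and the two constants cancel; only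
    the error term contributes. *)
Lemma contour_affine_close x0 x1 y0 y1 f z c e : continuous_on_lines f ->
  x0 <= x1 -> y0 <= y1 ->
  (forall w, in_rect x0 x1 y0 y1 w -> normc (f w - f z - c * (w - z)) <= e) ->
  normc (contour x0 x1 y0 y1 f) <= 4 * e * ((x1 - x0) + (y1 - y0)).
Proof.
move=> [cx cy] x01 y01 h.
have csub (g k : R -> R[i]) : continuous g -> continuous k ->
    continuous (fun t => - 1 * g t + k t).
  move=> cg ck t; apply: cvgD; last exact: ck.
  by apply: cvgM; [exact: cvg_cst|exact: cg].
have dif p q (g k : R -> R[i]) : continuous g -> continuous k ->
    cseg_int p q k - cseg_int p q g = cseg_int p q (fun t => - 1 * g t + k t).
  by move=> cg ck; rewrite cseg_int_lin // mulN1r addrC.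
have step p q (g k : R -> R[i]) u v d : p <= q -> continuous g -> continuous k ->
    (forall t, p <= t <= q -> normc (g t - u t) <= e) ->
    (forall t, p <= t <= q -> normc (k t - v t) <= e) ->
    (forall t, v t - u t = d) ->
    normc (cseg_int p q k - cseg_int p q g - (q - p)%:C * d) <= 4 * e * (q - p).
  move=> pq cg ck hg hk uv; rewrite dif //.
  have -> : 4 * e = 2 * (e + e) by ring.
  apply: (@cseg_int_close _ p q d (e + e) (fun t => - 1 * g t + k t)
    (csub g k cg ck) pq) => t tpq.
  have -> : -1 * g t + k t - d = (k t - v t) + - (g t - u t).
    by rewrite -(uv t); ring.
  apply: (le_trans (le_normcD _ _)); rewrite normcN.
  by apply: lerD; [exact: hk|exact: hg].
pose A w := f z + c * (w - z).
have hA w : in_rect x0 x1 y0 y1 w -> normc (f w - A w) <= e.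
  by move=> /h; rewrite /A opprD addrA.
have h1 := @step x0 x1 (fun x => f (x +i* y1)) (fun x => f (x +i* y0))
  (fun x => A (x +i* y1)) (fun x => A (x +i* y0)) (c * (0 +i* (y0 - y1)))
  x01 (cx _) (cx _).
have h2 := @step y0 y1 (fun y => f (x0 +i* y)) (fun y => f (x1 +i* y))
  (fun y => A (x0 +i* y)) (fun y => A (x1 +i* y)) (c * ((x1 - x0) +i* 0))
  y01 (cy _) (cy _).
have {h1}h1 : normc (cseg_int x0 x1 (fun x => f (x +i* y0))
  - cseg_int x0 x1 (fun x => f (x +i* y1))
  - (x1 - x0)%:C * (c * (0 +i* (y0 - y1)))) <= 4 * e * (x1 - x0).
  apply: h1 => [t tx|t tx|t]; [apply: hA|apply: hA|].
  - by split=> //=; rewrite y01 lexx.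
  - by split=> //=; rewrite y01 lexx.
  - rewrite /A; have -> : 0 +i* (y0 - y1) = (t +i* y0) - (t +i* y1) :> R[i].
      by apply/eqP; rewrite eq_complex /= subrr !eqxx.
    ring.
have {h2}h2 : normc (cseg_int y0 y1 (fun y => f (x1 +i* y))
  - cseg_int y0 y1 (fun y => f (x0 +i* y))
  - (y1 - y0)%:C * (c * ((x1 - x0) +i* 0))) <= 4 * e * (y1 - y0).
  apply: h2 => [t ty|t ty|t]; [apply: hA|apply: hA|].
  - by split=> //=; rewrite x01 lexx.
  - by split=> //=; rewrite x01 lexx.
  - rewrite /A; have -> : (x1 - x0) +i* 0 = (x1 +i* t) - (x0 +i* t) :> R[i].
      by apply/eqP; rewrite eq_complex /= subrr !eqxx.
    ring.
rewrite /contour.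
set X := cseg_int x0 x1 _ - cseg_int x0 x1 _ in h1 *.
set Y := cseg_int y0 y1 _ - cseg_int y0 y1 _ in h2 *.
have eq0 : (x1 - x0)%:C * (0 +i* (y0 - y1))
   + 'i * ((y1 - y0)%:C * ((x1 - x0) +i* 0)) = 0 :> R[i].
  by apply/eqP; rewrite eq_complex /=; apply/andP; split; apply/eqP; ring.
have -> : X + 'i * Y = (X - (x1 - x0)%:C * (c * (0 +i* (y0 - y1))))
   + 'i * (Y - (y1 - y0)%:C * (c * ((x1 - x0) +i* 0))).
  transitivity (X + 'i * Y - c * ((x1 - x0)%:C * (0 +i* (y0 - y1))
   + 'i * ((y1 - y0)%:C * ((x1 - x0) +i* 0)))); last by ring.
  by rewrite eq0 mulr0 subr0.
rewrite [4 * e * _]mulrDr; apply: (le_trans (le_normcD _ _)); apply: lerD => //.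
rewrite Normc.normcM.
have -> : normc 'i = 1 :> R by rewrite /= expr0n expr1n add0r sqrtr1.
by rewrite mul1r.
Qed.

(** Differentiability relative to the rectangle, so that it applies to
    functions precomposed with [cclamp]. *)
Definition differentiable_in_rect x0 x1 y0 y1 f z :=
  exists c, forall e, 0 < e -> exists2 d, 0 < d &
    forall w, in_rect x0 x1 y0 y1 w -> normc (w - z) < d ->
      normc (f w - f z - c * (w - z)) <= e * normc (w - z).

(** Bisection in both directions: if the integral exceeded [e] times the
    square of the half perimeter, one of the four quarters would exceed the
    corresponding bound, since the bound is divided by exactly four. The
    nested rectangles shrink to a point, where differentiability makes the
    integral negligible compared with that square. This reaches functions that
    are merely differentiable at each point, as the discs of
    [holomorphic_disc] are. *)
Lemma goursat x0 x1 y0 y1 f : continuous_on_lines f ->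
  x0 <= x1 -> y0 <= y1 ->
  (forall z, in_rect x0 x1 y0 y1 z -> differentiable_in_rect x0 x1 y0 y1 f z) ->
  contour x0 x1 y0 y1 f = 0.
Proof.
move=> cf x01 y01 df.
pose W := x1 - x0; pose H := y1 - y0.
have W0 : 0 <= W by rewrite subr_ge0.
have H0 : 0 <= H by rewrite subr_ge0.
suff small e : 0 < e -> normc (contour x0 x1 y0 y1 f) <= e * (W + H) ^+ 2.
  apply: Normc.eq0_normc; apply/eqP; rewrite eq_le normc_ge0 andbT.
  apply/ler_addgt0Pl => e e0; rewrite addr0.
  have h0 : 0 < (W + H) ^+ 2 + 1 by rewrite ltr_wpDl // sqr_ge0.
  apply: (le_trans (small _ (divr_gt0 e0 h0))).
  rewrite mulrAC ler_pdivrMr //; apply: ler_wpM2l; first exact: ltW.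
  by rewrite lerDl.
move=> e0; rewrite leNgt; apply/negP => bad0.
pose w_ k : R := W / 2 ^+ k; pose h_ k : R := H / 2 ^+ k.
have w_ge0 k : 0 <= w_ k by rewrite divr_ge0 // exprn_ge0.
have h_ge0 k : 0 <= h_ k by rewrite divr_ge0 // exprn_ge0.
have wS k : w_ k = w_ k.+1 + w_ k.+1.
  by rewrite /w_ exprS; field; rewrite expf_neq0.
have hS k : h_ k = h_ k.+1 + h_ k.+1.
  by rewrite /h_ exprS; field; rewrite expf_neq0.
pose bad k (p : R * R) := e * (w_ k + h_ k) ^+ 2
  < normc (contour p.1 (p.1 + w_ k) p.2 (p.2 + h_ k) f).
have step k p : exists q : R * R, bad k p -> bad k.+1 q /\
   ((q.1 = p.1 \/ q.1 = p.1 + w_ k.+1) /\ (q.2 = p.2 \/ q.2 = p.2 + h_ k.+1)).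
  have [hb|nb] := pselect (bad k p); last by exists p.
  case: p hb => x y hb.
  apply: contrapT => /forallNP no.
  have sm x' y' : x' = x \/ x' = x + w_ k.+1 -> y' = y \/ y' = y + h_ k.+1 ->
      normc (contour x' (x' + w_ k.+1) y' (y' + h_ k.+1) f)
      <= e * (w_ k.+1 + h_ k.+1) ^+ 2.
    move=> hx hy; rewrite leNgt; apply/negP => hb'.
    by apply: (no (x', y')) => _; split.
  move: hb; rewrite /bad -[(x, y).1]/x -[(x, y).2]/y ltNge => /negP; apply.
  have -> : x + w_ k = x + w_ k.+1 + w_ k.+1 by rewrite [w_ k]wS addrA.
  have -> : y + h_ k = y + h_ k.+1 + h_ k.+1 by rewrite [h_ k]hS addrA.
  rewrite (@contour_split4 x (x + w_ k.+1) _ y (y + h_ k.+1)) // ?lerDl //.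
  have -> : e * (w_ k + h_ k) ^+ 2 =
     (e * (w_ k.+1 + h_ k.+1) ^+ 2 + e * (w_ k.+1 + h_ k.+1) ^+ 2)
     + (e * (w_ k.+1 + h_ k.+1) ^+ 2 + e * (w_ k.+1 + h_ k.+1) ^+ 2).
    by rewrite [w_ k]wS [h_ k]hS; ring.
  apply: (le_trans (le_normcD _ _)); apply: lerD;
    apply: (le_trans (le_normcD _ _)); apply: lerD; apply: sm; by [left|right].
have [nxt nxtP] := choice (fun kp : nat * (R * R) => step kp.1 kp.2).
pose s := fix s k : R * R := if k is k'.+1 then nxt (k', s k') else (x0, y0).
have sbad k : bad k (s k).
  elim: k => [|k ih]; last by have [] := nxtP (k, s k) ih.
  rewrite /bad -[(s 0%N).1]/x0 -[(s 0%N).2]/y0 /w_ /h_ expr0 !divr1 /W /H.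
  by rewrite (addrC x0) subrK (addrC y0) subrK.
have s1 k : s k.+1 = nxt (k, s k) by [].
have sstep k := (nxtP (k, s k) (sbad k)).2.
(* the lower left corners of the chosen quarters increase, and the upper
   right ones decrease *)
have nest (u v : nat -> R) : (forall k, 0 <= v k) ->
   (forall k, v k = v k.+1 + v k.+1) ->
   (forall k, u k.+1 = u k \/ u k.+1 = u k + v k.+1) ->
   exists l, forall k, u k <= l <= u k + v k.
  move=> v0 vS uS.
  have up k : u k <= u k.+1 by case: (uS k) => -> //; rewrite lerDl.
  have dn k : u k.+1 + v k.+1 <= u k + v k.
    by rewrite [v k]vS; have := v0 k.+1; case: (uS k) => ->; lra.
  have upm k j : u k <= u (j + k)%N.
    by elim: j => // j ih; rewrite addSn; exact: le_trans ih (up _).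
  have dnm k j : u (j + k)%N + v (j + k)%N <= u k + v k.
    by elim: j => // j ih; rewrite addSn; exact: le_trans (dn _) ih.
  have ub k j : u j <= u k + v k.
    have [kj|jk] := leqP k j.
      rewrite -(subnK kj); apply: le_trans (dnm k (j - k)%N).
      by rewrite lerDl.
    by rewrite -(subnK (ltnW jk)) (le_trans (upm j (k - j)%N)) // lerDl.
  have hs : has_sup (range u).
    by split; [exists (u 0%N); exists 0%N|exists (u 0%N + v 0%N) => _ [j _ <-]].
  exists (sup (range u)) => k; apply/andP; split.
    by apply: sup_upper_bound => //; exists k.
  by apply: ge_sup; [exists (u 0%N); exists 0%N|move=> _ [j _ <-]].
have [X hX] := nest (fun k => (s k).1) w_ w_ge0 wS (fun k => (sstep k).1).
have [Y hY] := nest (fun k => (s k).2) h_ h_ge0 hS (fun k => (sstep k).2).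
have zin : in_rect x0 x1 y0 y1 (X +i* Y).
  move: (hX 0%N) (hY 0%N); rewrite /= /w_ /h_ expr0 !divr1 /W /H.
  by rewrite (addrC x0) subrK (addrC y0) subrK; split.
have [c hc] := df _ zin.
have e8 : 0 < e / 8 by rewrite divr_gt0.
have [d d0 hd] := hc _ e8.
have [k hk] : exists k, w_ k + h_ k < d.
  have WH0 : 0 <= (W + H) / d by apply: divr_ge0; [exact: addr_ge0|exact: ltW].
  have [n hn] : exists n : nat, (W + H) / d < n%:R.
    by exists (Num.bound ((W + H) / d)); exact: archi_boundP.
  exists n; rewrite /w_ /h_ -mulrDl ltr_pdivrMr ?exprn_gt0 //.
  rewrite mulrC -ltr_pdivrMr //; apply: (lt_trans hn).
  by rewrite -natrX ltr_nat ltn_expl.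
pose p := s k.
have sub w : in_rect p.1 (p.1 + w_ k) p.2 (p.2 + h_ k) w ->
    in_rect x0 x1 y0 y1 w.
  have dnx j : x0 <= (s j).1 /\ (s j).1 + w_ j <= x1.
    elim: j => [|j [l r]].
      by rewrite /= /w_ expr0 divr1 /W (addrC x0) subrK.
    have v0 := w_ge0 j.+1; have vS := wS j.
    by have := (sstep j).1; rewrite -s1 => -[->|->]; split; lra.
  have dny j : y0 <= (s j).2 /\ (s j).2 + h_ j <= y1.
    elim: j => [|j [l r]].
      by rewrite /= /h_ expr0 divr1 /H (addrC y0) subrK.
    have v0 := h_ge0 j.+1; have vS := hS j.
    by have := (sstep j).2; rewrite -s1 => -[->|->]; split; lra.
  have [a1 a2] := dnx k; have [b1 b2] := dny k.
  rewrite -/p in a1 a2 b1 b2.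
  by move=> [/andP[? ?] /andP[? ?]]; split; apply/andP; split; lra.
have := sbad k; rewrite /bad -/p ltNge => /negP; apply.
pose m := w_ k + h_ k.
have m0 : 0 <= m by rewrite addr_ge0.
have := @contour_affine_close p.1 (p.1 + w_ k) p.2 (p.2 + h_ k) f (X +i* Y) c
  (e / 8 * m) cf.
rewrite !lerDl => /(_ (w_ge0 k) (h_ge0 k)) hh.
apply: (le_trans (hh _)); last first.
  rewrite (addrC p.1) addrK (addrC p.2) addrK -/m.
  have := mulr_ge0 (ltW e0) (sqr_ge0 m); nra.
move=> w hw.
have hwz : normc (w - (X +i* Y)) <= m.
  apply: (le_trans (normc_le_ReIm _)).
  move: (hX k) (hY k) hw; rewrite -/p => /andP[? ?] /andP[? ?].
  case: w => u v [/= /andP[? ?] /andP[? ?]].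
  by apply: lerD; rewrite ler_norml; apply/andP; split; lra.
apply: (le_trans (hd _ (sub _ hw) (le_lt_trans hwz hk))).
by rewrite ler_wpM2l // ltW.
Qed.

End Goursat.

(** * Complex derivatives *)

Section ComplexDerivative.
Context {R : realType} {V : normedModType R[i]}.
Implicit Types (z w h : R[i]) (f : R[i] -> V) (u v c : V).

(** The norm of a module over [R[i]] takes values in [R[i]]; this is the same
    norm as a real number. *)
Definition vnorm v : R := Re `|v|.

Lemma vnormE v : `|v| = (vnorm v)%:C.
Proof. rewrite RRe_real // ger0_real //; exact: normr_ge0. Qed.

Lemma vnorm_ge0 v : 0 <= vnorm v.
Proof. by rewrite -lecR -vnormE; exact: normr_ge0. Qed.

Lemma vnormD u v : vnorm (u + v) <= vnorm u + vnorm v.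
Proof. by have := ler_normD u v; rewrite !vnormE -rmorphD lecR. Qed.

Lemma vnormN v : vnorm (- v) = vnorm v.
Proof. by rewrite /vnorm normrN. Qed.

Lemma vnormBC u v : vnorm (u - v) = vnorm (v - u).
Proof. by rewrite -vnormN opprB. Qed.

Lemma vnormZ z v : vnorm (z *: v) = normc z * vnorm v.
Proof.
by have := normrZ z v; rewrite normE !vnormE -rmorphM => /complexI.
Qed.

Lemma cvg_vnormP {T : Type} {F : set_system T} {FF : Filter F} (g : T -> V) v :
  g @ F --> v <-> forall e : R, 0 < e -> \forall t \near F, vnorm (v - g t) < e.
Proof.
split=> [/cvgrPdist_lt h e e0|h].
  have e0' : 0 < e%:C :> R[i] by rewrite ltcR.
  by apply: filterS (h _ e0') => t; rewrite vnormE ltcR.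
apply/cvgrPdist_lt => e /gtc0E[r r0 ->].
by apply: filterS (h _ r0) => t; rewrite vnormE ltcR.
Qed.

Lemma nbhs_normcP z (P : R[i] -> Prop) :
  nbhs z P <-> exists2 d : R, 0 < d & forall h, normc h < d -> P (z + h).
Proof.
split=> [/nbhs_ballP[_ /gtc0E[d d0 ->] dP]|[d d0 dP]].
  exists d => // h hd; apply: dP; rewrite -ball_normE /ball_ /=.
  by rewrite opprD addNKr normrN ltcR_norm.
have := near_normc z d0; apply: (@filterS _ (nbhs z) _) => t zt.
by rewrite -[t](subrK z) addrC; apply: dP; rewrite -normcN opprB.
Qed.

Lemma nbhs_vnormP v (P : V -> Prop) :
  nbhs v P <-> exists2 d : R, 0 < d & forall u, vnorm (v - u) < d -> P u.
Proof.
split=> [/nbhs_ballP[_ /gtc0E[d d0 ->] dP]|[d d0 dP]].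
  exists d => // h hd; apply: dP; rewrite -ball_normE /ball_ /=.
  by rewrite vnormE ltcR.
apply/nbhs_ballP; exists d%:C; first by rewrite /= ltcR.
by move=> u; rewrite -ball_normE /ball_ /= vnormE ltcR; exact: dP.
Qed.

(** Complex differentiability with quantifiers over the reals, equivalent to
    [derivable f z 1] by [has_cderivP]. *)
Definition has_cderiv f z c := forall e : R, 0 < e -> exists2 d : R, 0 < d &
  forall h, normc h < d -> vnorm (f (z + h) - f z - h *: c) <= e * normc h.

Lemma normc_gt0 h : h != 0 -> 0 < normc h.
Proof.
move=> h0; rewrite lt_neqAle normc_ge0 andbT eq_sym.
by apply: contra h0 => /eqP/Normc.eq0_normc ->.
Qed.

Lemma has_cderivP f z c :
  has_cderiv f z c <-> (fun h => h^-1 *: (f (h *: 1 + z) - f z)) @ 0^' --> c.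
Proof.
have eq1 h : h != 0 -> vnorm (c - h^-1 *: (f (h *: 1 + z) - f z)) =
    (normc h)^-1 * vnorm (f (z + h) - f z - h *: c).
  move=> h0; rewrite -Normc.normcV -vnormZ [in RHS]scalerBr [in RHS]scalerA mulVf // scale1r.
  have -> : h *: 1 = h :> R[i] by exact: mulr1.
  by rewrite vnormBC (addrC z).
split=> [fz|/cvg_vnormP fz e e0].
  apply/cvg_vnormP => e e0.
  have [d d0 hd] := fz _ (divr_gt0 e0 (ltr0Sn R 1)).
  apply/nbhs_normcP; exists d => // h; rewrite add0r => hd' h0.
  rewrite eq1 //; apply: (@le_lt_trans _ _ (e / 2)); last by move: e0; lra.
  by rewrite mulrC ler_pdivrMr ?normc_gt0 //; exact: hd.
have /nbhs_normcP[d d0 hd] := fz _ e0.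
exists d => // h hd'.
have [->|h0] := eqVneq h 0.
  by rewrite addr0 subrr scale0r subrr Normc.normc0 mulr0 /vnorm normr0.
have := hd _ hd'; rewrite add0r => /(_ h0); rewrite eq1 // mulrC.
by rewrite ltr_pdivrMr ?normc_gt0 // => /ltW.
Qed.

Lemma derivable_has_cderiv f z : derivable f z 1 -> has_cderiv f z ('D_1 f z).
Proof. by move=> h; apply/has_cderivP. Qed.

Lemma has_cderiv_derivable f z c : has_cderiv f z c -> derivable f z 1.
Proof. by move=> /has_cderivP h; apply/cvg_ex; exists c. Qed.

Lemma has_cderiv_local f g z c d : 0 < d ->
  (forall h, normc h < d -> f (z + h) = g (z + h)) ->
  has_cderiv f z c -> has_cderiv g z c.
Proof.
move=> d0 fg df e e0; have [d1 d10 hd] := df e e0.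
exists (Num.min d d1); first by rewrite lt_min d0.
move=> h; rewrite lt_min => /andP[h1 h2]; rewrite -fg // -[g z]/(g z).
have := fg 0; rewrite addr0 Normc.normc0 => /(_ d0) <-.
exact: hd.
Qed.

Lemma has_cderiv_continuous f z c : has_cderiv f z c ->
  forall e : R, 0 < e -> exists2 d : R, 0 < d &
    forall h, normc h < d -> vnorm (f (z + h) - f z) < e.
Proof.
move=> df e e0; have [d d0 hd] := df 1 ltr01.
have K0 : 0 < 1 + vnorm c by rewrite ltr_pwDl // vnorm_ge0.
exists (Num.min d (e / (1 + vnorm c))); first by rewrite lt_min d0 divr_gt0.
move=> h; rewrite lt_min => /andP[h1 h2].
have -> : f (z + h) - f z = (f (z + h) - f z - h *: c) + h *: c by rewrite subrK.
apply: (le_lt_trans (vnormD _ _)); rewrite vnormZ.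
apply: (@le_lt_trans _ _ (normc h * (1 + vnorm c))).
  by have := hd _ h1; rewrite mul1r mulrDr mulr1 => ?; rewrite lerD2r.
by rewrite -ltr_pdivlMr.
Qed.

End ComplexDerivative.

Section ComplexDerivativeScalar.
Context {R : realType}.
Implicit Types (z w h c : R[i]).

Lemma vnorm_normc z : @vnorm R R[i] z = normc z.
Proof. by apply: complexI; rewrite -vnormE normE. Qed.

Lemma has_cderiv_comp (V : normedModType R[i]) (f : R[i] -> V) (g : R[i] -> R[i]) z c v :
  has_cderiv g z c -> has_cderiv f (g z) v -> has_cderiv (fun x => f (g x)) z (c *: v).
Proof.
move=> dg df e e0.
have K0 : 0 < 1 + normc c by rewrite ltr_pwDl // normc_ge0.
have L0 : 0 < 1 + vnorm v by rewrite ltr_pwDl // vnorm_ge0.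
pose e1 := e / (2 * (1 + normc c)); pose e2 := Num.min 1 (e / (2 * (1 + vnorm v))).
have e10 : 0 < e1 by rewrite divr_gt0 // mulr_gt0.
have e20 : 0 < e2 by rewrite lt_min ltr01 divr_gt0 // mulr_gt0.
have [d1 d10 h1] := df _ e10; have [d2 d20 h2] := dg _ e20.
have [d3 d30 h3] := has_cderiv_continuous dg d10.
exists (Num.min d2 d3); first by rewrite lt_min d20.
move=> h; rewrite lt_min => /andP[hd2 hd3] /=.
have := h2 _ hd2; rewrite vnorm_normc => g2.
have := h3 _ hd3; rewrite vnorm_normc => /h1.
set k := g (z + h) - g z in g2 *.
have -> : g z + k = g (z + h) by rewrite /k addrC subrK.
move=> g1.
have -> : f (g (z + h)) - f (g z) - h *: (c *: v) =
    (f (g (z + h)) - f (g z) - k *: v) + (k - h *: c) *: v.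
  have -> : (k - h *: c) *: v = k *: v - h *: (c *: v).
    by rewrite scalerA -scalerBl.
  by rewrite addrA subrK.
apply: (le_trans (vnormD _ _)); rewrite vnormZ.
have n0 := normc_ge0 h.
have hk : normc k <= (1 + normc c) * normc h.
  have -> : k = (k - h *: c) + h * c by rewrite /GRing.scale /= subrK.
  apply: (le_trans (le_normcD _ _)); rewrite Normc.normcM mulrDl mul1r (mulrC (normc h)).
  rewrite lerD2r; apply: (le_trans g2); rewrite ler_piMl //.
  by rewrite ge_min lexx.
have a1 : vnorm (f (g (z + h)) - f (g z) - k *: v) <= e / 2 * normc h.
  apply: (le_trans g1).
  have -> : e / 2 * normc h = e1 * ((1 + normc c) * normc h).
    by rewrite /e1; field; rewrite gt_eqF.
  by apply: ler_wpM2l => //; exact: ltW.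
have a2 : normc (k - h *: c) * vnorm v <= e / 2 * normc h.
  have e2le : e2 <= e / (2 * (1 + vnorm v)) by rewrite ge_min lexx orbT.
  apply: (@le_trans _ _ (e / (2 * (1 + vnorm v)) * normc h * (1 + vnorm v))).
    apply: ler_pM; rewrite ?normc_ge0 ?vnorm_ge0 //; last by rewrite lerDr.
    by apply: (le_trans g2); rewrite ler_wpM2r.
  rewrite le_eqVlt; apply/orP; left; apply/eqP.
  by field; rewrite gt_eqF.
by apply: (le_trans (lerD a1 a2)); rewrite -mulrDl -splitr.
Qed.

End ComplexDerivativeScalar.

(** * Goursat's lemma with a removable singularity *)

Section RemovableSingularity.
Context {R : realType}.
Implicit Types (e t : R) (b c z w h : R[i]) (f g : R[i] -> R[i]).

Lemma derivable_slope f b z : z != b -> derivable f z 1 ->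
  derivable (fun w => (f w - f b) / (w - b)) z 1.
Proof.
move=> zb df.
have d1 : derivable (fun w => f w - f b) z 1.
  exact: (@derivableB R[i] R[i] R[i] f (cst (f b)) z 1 df
    (@derivable_cst R[i] R[i] R[i] _ _ _)).
have d2 : derivable (fun w : R[i] => w - b) z 1.
  exact: (@derivableB R[i] R[i] R[i] id (cst b) z 1 (@derivable_id _ _ _ _)
    (@derivable_cst R[i] R[i] R[i] _ _ _)).
have d3 : derivable (fun w : R[i] => (w - b)^-1) z 1.
  by apply: (@derivableV R[i] R[i]) => //; rewrite subr_eq0.
exact: (@derivableM R[i] R[i] _ (fun w => (w - b)^-1) z 1 d1 d3).
Qed.

(** The difference quotient, completed by the derivative at [b]; it is
    continuous, and differentiable off [b]. *)
Definition slope f b z : R[i] :=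
  if z == b then 'D_1 f b else (f z - f b) / (z - b).

Definition cont_at f z := forall e, 0 < e -> exists2 d : R, 0 < d &
  forall h, normc h < d -> normc (f (z + h) - f z) < e.

Lemma has_cderiv_cont_at f z c : has_cderiv f z c -> cont_at f z.
Proof.
move=> df e e0; have [d d0 hd] := has_cderiv_continuous df e0.
by exists d => // h /hd; rewrite vnorm_normc.
Qed.

Lemma slope_cderiv f b z : z != b -> derivable f z 1 ->
  exists c, has_cderiv (slope f b) z c.
Proof.
move=> zb df; exists ('D_1 (fun w => (f w - f b) / (w - b)) z).
have n0 : 0 < normc (b - z) by rewrite normc_gt0 // subr_eq0 eq_sym.
apply: (has_cderiv_local n0); last exact/derivable_has_cderiv/derivable_slope.
move=> h hlt; rewrite /slope; case: eqP => // hb; move: hlt.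
by rewrite -hb addrAC subrr add0r ltxx.
Qed.

Lemma slope_cont_at f b z : derivable f b 1 -> derivable f z 1 ->
  cont_at (slope f b) z.
Proof.
move=> fb fz; have [->|zb] := eqVneq z b; last first.
  by have [c /has_cderiv_cont_at] := slope_cderiv zb fz.
move=> e e0; have [d d0 hd] := derivable_has_cderiv fb (divr_gt0 e0 (ltr0Sn R 1)).
exists d => // h hlt; rewrite /slope eqxx.
have [->|h0] := eqVneq h 0; first by rewrite addr0 eqxx subrr Normc.normc0.
have -> : (b + h == b) = false.
  by apply/negP => /eqP E; move/eqP: h0; apply; rewrite -(addrK b h) (addrC h) E subrr.
have -> : (f (b + h) - f b) / (b + h - b) - 'D_1 f b =
    (f (b + h) - f b - h *: 'D_1 f b) / h.
  rewrite (addrC b) addrK -[h *: _]/(h * _).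
  by field.
rewrite Normc.normcM Normc.normcV ltr_pdivrMr ?normc_gt0 //.
have := hd _ hlt; rewrite vnorm_normc => /le_lt_trans; apply.
rewrite ltr_pM2r ?normc_gt0 //; move: e0; lra.
Qed.

Definition clamp (l u t : R) : R := Num.max l (Num.min u t).

Lemma clamp_lip l u t s : `|clamp l u t - clamp l u s| <= `|t - s|.
Proof.
rewrite /clamp /Num.max /Num.min.
do ?case: ifPn => //; rewrite -?leNgt => *; do 2 (case: ler0P => //) => *; lra.
Qed.

Lemma clamp_in l u t : l <= u -> l <= clamp l u t <= u.
Proof.
move=> lu; rewrite /clamp le_max lexx /= ge_max lu /= ge_min lexx //.
Qed.

Lemma clamp_id l u t : l <= t <= u -> clamp l u t = t.
Proof. by move=> /andP[lt tu]; rewrite /clamp min_r // max_r. Qed.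

(** Projection onto a rectangle; precomposing with it turns a function that is
    continuous on the rectangle into one that is continuous everywhere, so
    that the integrals involve only total continuous functions. *)
Definition cclamp x0 x1 y0 y1 z : R[i] := clamp x0 x1 (Re z) +i* clamp y0 y1 (Im z).

Lemma cont_at_clamp x0 x1 y0 y1 f : x0 <= x1 -> y0 <= y1 ->
  (forall z, in_rect x0 x1 y0 y1 z -> cont_at f z) ->
  continuous (fun z => f (cclamp x0 x1 y0 y1 z)).
Proof.
move=> x01 y01 cf z; apply/(@cvg_cplxP _ _ _ (nbhs_filter z)) => e e0.
have [|d d0 hd] := cf (cclamp x0 x1 y0 y1 z) _ _ e0.
  by split; exact: clamp_in.
apply/nbhs_normcP; exists (d / 2); first by rewrite divr_gt0.
move=> h hlt; rewrite -normcN opprB.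
have -> : cclamp x0 x1 y0 y1 (z + h) = cclamp x0 x1 y0 y1 z +
  (cclamp x0 x1 y0 y1 (z + h) - cclamp x0 x1 y0 y1 z) by rewrite [RHS]addrC subrK.
apply: hd; apply: (le_lt_trans (normc_le_ReIm _)).
have := normc_Re h; have := normc_Im h.
have := clamp_lip x0 x1 (Re (z + h)) (Re z).
have := clamp_lip y0 y1 (Im (z + h)) (Im z).
have -> : Re (z + h) - Re z = Re h by case: (z) (h) => [? ?] [? ?] /=; ring.
have -> : Im (z + h) - Im z = Im h by case: (z) (h) => [? ?] [? ?] /=; ring.
rewrite /cclamp -[Re (_ - _)]/(clamp x0 x1 (Re (z + h)) - clamp x0 x1 (Re z)).
rewrite -[Im (_ - _)]/(clamp y0 y1 (Im (z + h)) - clamp y0 y1 (Im z)).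
by move: hlt; lra.
Qed.

Lemma cclamp_id x0 x1 y0 y1 z : in_rect x0 x1 y0 y1 z -> cclamp x0 x1 y0 y1 z = z.
Proof. by case: z => x y [/= hx hy]; rewrite /cclamp /= !clamp_id. Qed.

Lemma continuous_lines f : continuous f -> continuous_on_lines f.
Proof.
move=> cf; split=> s t.
  apply: (@continuous_comp _ _ _ (fun x => x +i* s) f); last exact: cf.
  apply/cvg_cplxP => e e0.
  have : (id : R -> R) @ t --> t by exact: cvg_id.
  move/cvgrPdist_lt/(_ e e0); apply: filterS => u.
  by rewrite /= subrr expr0n addr0 sqrtr_sqr.
apply: (@continuous_comp _ _ _ (fun y => s +i* y) f); last exact: cf.
apply/cvg_cplxP => e e0.
have : (id : R -> R) @ t --> t by exact: cvg_id.
move/cvgrPdist_lt/(_ e e0); apply: filterS => u.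
by rewrite /= subrr expr0n add0r sqrtr_sqr.
Qed.

Lemma contour_splitx x0 xm x1 y0 y1 f : continuous_on_lines f ->
  x0 <= xm -> xm <= x1 ->
  contour x0 x1 y0 y1 f = contour x0 xm y0 y1 f + contour xm x1 y0 y1 f.
Proof.
move=> [cx cy] x0m xm1; rewrite /contour.
rewrite (cseg_int_split (cx y0) x0m xm1) (cseg_int_split (cx y1) x0m xm1).
ring.
Qed.

Lemma contour_splity x0 x1 y0 ym y1 f : continuous_on_lines f ->
  y0 <= ym -> ym <= y1 ->
  contour x0 x1 y0 y1 f = contour x0 x1 y0 ym f + contour x0 x1 ym y1 f.
Proof.
move=> [cx cy] y0m ym1; rewrite /contour.
rewrite (cseg_int_split (cy x0) y0m ym1) (cseg_int_split (cy x1) y0m ym1).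
ring.
Qed.

(** Cut out a small square around the exceptional point: the four surrounding
    rectangles contribute nothing by Goursat's lemma, and the square
    contributes at most a multiple of its side because [f] is locally bounded.
    *)
Lemma goursat_removable x0 x1 y0 y1 f z : continuous f ->
  x0 < Re z < x1 -> y0 < Im z < y1 ->
  (forall w, in_rect x0 x1 y0 y1 w -> w != z ->
     differentiable_in_rect x0 x1 y0 y1 f w) ->
  contour x0 x1 y0 y1 f = 0.
Proof.
move=> cf; case: z => a1 a2 /= /andP[xa ax] /andP[ya ay] df.
have cl := continuous_lines cf.
have sub u0 u1 v0 v1 : x0 <= u0 -> u0 <= u1 -> u1 <= x1 -> y0 <= v0 ->
   v0 <= v1 -> v1 <= y1 -> ~ in_rect u0 u1 v0 v1 (a1 +i* a2) ->
   contour u0 u1 v0 v1 f = 0.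
  move=> xu uu ux yv vv vy na; apply: goursat => // w hw.
  have inc w' : in_rect u0 u1 v0 v1 w' -> in_rect x0 x1 y0 y1 w'.
    by move=> [/andP[? ?] /andP[? ?]]; split; apply/andP; split; lra.
  have wa : w != a1 +i* a2 by apply/eqP => E; apply: na; rewrite -E.
  have [c hc] := df _ (inc _ hw) wa.
  exists c => e e0; have [d d0 hd] := hc _ e0.
  by exists d => // w' /inc; exact: hd.
have [d d0 hd] : exists2 d : R, 0 < d & forall w, normc (w - (a1 +i* a2)) < d ->
    normc (f w - f (a1 +i* a2)) <= 1.
  have := cf (a1 +i* a2).
  move/(@cvg_cplxP _ _ _ (nbhs_filter _))/(_ 1 ltr01)/nbhs_normcP => [d d0 hd].
  exists d => // w hw; apply: ltW; rewrite -normcN opprB.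
  have E : (a1 +i* a2) + (w - (a1 +i* a2)) = w by rewrite addrC subrK.
  by have := hd _ hw; rewrite E.
apply: Normc.eq0_normc; apply/eqP; rewrite eq_le normc_ge0 andbT.
apply/ler_addgt0Pl => e e0; rewrite addr0.
pose s := Num.min (Num.min (d / 4) (e / 16))
  (Num.min (Num.min (a1 - x0) (x1 - a1)) (Num.min (a2 - y0) (y1 - a2))).
have s0 : 0 < s by rewrite !lt_min !divr_gt0 //= !subr_gt0 xa ax ya ay.
have [sd [se [sx0 [sx1 [sy0 sy1]]]]] :
  s <= d / 4 /\ s <= e / 16 /\ s <= a1 - x0 /\ s <= x1 - a1 /\
  s <= a2 - y0 /\ s <= y1 - a2.
  by rewrite !ge_min !lexx !orbT.
have out u0 u1 v0 v1 : (u1 < a1) || (a1 < u0) || (v1 < a2) || (a2 < v0) ->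
    ~ in_rect u0 u1 v0 v1 (a1 +i* a2).
  by move=> h [/= /andP[h1 h2] /andP[h3 h4]]; move: h; rewrite !ltNge h1 h2 h3 h4.
rewrite (@contour_splitx x0 (a1 - s) x1) //; [|lra|lra].
rewrite (@contour_splitx (a1 - s) (a1 + s) x1) //; [|lra|lra].
rewrite (@contour_splity (a1 - s) (a1 + s) y0 (a2 - s) y1) //; [|lra|lra].
rewrite (@contour_splity (a1 - s) (a1 + s) (a2 - s) (a2 + s) y1) //; [|lra|lra].
rewrite (sub x0 (a1 - s)); [|lra|lra|lra|lra|lra|lra|]; last first.
  by apply: out; rewrite ltrBlDr ltrDl s0.
rewrite (sub (a1 + s) x1); [|lra|lra|lra|lra|lra|lra|]; last first.
  by apply: out; rewrite ltrDl s0 orbT.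
rewrite (sub (a1 - s) (a1 + s) y0); [|lra|lra|lra|lra|lra|lra|]; last first.
  by apply: out; rewrite [X in _ || X || _]ltrBlDr ltrDl s0 !orbT.
rewrite (sub (a1 - s) (a1 + s) (a2 + s)); [|lra|lra|lra|lra|lra|lra|]; last first.
  by apply: out; rewrite [X in _ || X]ltrDl s0 !orbT.
rewrite !add0r !addr0.
apply: (@le_trans _ _ (4 * 1 * ((a1 + s - (a1 - s)) + (a2 + s - (a2 - s))))); last by lra.
apply: (@contour_affine_close _ _ _ _ _ _ (a1 +i* a2) 0) => //; [lra|lra|].
move=> w [/andP[? ?] /andP[? ?]]; rewrite mul0r subr0; apply: hd.
apply: (le_lt_trans (normc_le_ReIm _)).
rewrite !raddfB /=.
have h1 : `|Re w - a1| <= s by rewrite ler_norml; apply/andP; split; lra.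
have h2 : `|Im w - a2| <= s by rewrite ler_norml; apply/andP; split; lra.
by lra.
Qed.

End RemovableSingularity.

(** * Contour estimates and the Cauchy kernel *)

Section ContourEstimates.
Context {R : realType}.
Implicit Types (e t : R) (b c z w h : R[i]) (f g : R[i] -> R[i]).

(** Continuity along the four sides only: the Cauchy kernel is singular inside
    the rectangle. *)
Definition edge_continuous x0 x1 y0 y1 f :=
  [/\ continuous (fun x => f (x +i* y0)), continuous (fun x => f (x +i* y1)),
      continuous (fun y => f (x0 +i* y)) & continuous (fun y => f (x1 +i* y))].

Definition on_edge x0 x1 y0 y1 z := in_rect x0 x1 y0 y1 z /\
  (Re z = x0 \/ Re z = x1 \/ Im z = y0 \/ Im z = y1).

Lemma contour_lin x0 x1 y0 y1 c f g :
  edge_continuous x0 x1 y0 y1 f -> edge_continuous x0 x1 y0 y1 g ->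
  contour x0 x1 y0 y1 (fun z => c * f z + g z) =
  c * contour x0 x1 y0 y1 f + contour x0 x1 y0 y1 g.
Proof.
move=> [f1 f2 f3 f4] [g1 g2 g3 g4]; rewrite /contour.
rewrite (cseg_int_lin _ _ _ f1 g1) (cseg_int_lin _ _ _ f2 g2).
rewrite (cseg_int_lin _ _ _ f3 g3) (cseg_int_lin _ _ _ f4 g4).
ring.
Qed.

Lemma eq_seg_int (l u : R) (p q : R -> R) :
  (forall t, l <= t <= u -> p t = q t) -> seg_int l u p = seg_int l u q.
Proof.
by move=> pq; apply: eq_Rintegral => t; rewrite inE /= in_itv /= => /pq.
Qed.

Lemma eq_cseg_int (l u : R) (p q : R -> R[i]) :
  (forall t, l <= t <= u -> p t = q t) -> cseg_int l u p = cseg_int l u q.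
Proof. by move=> pq; congr (_ +i* _); apply: eq_seg_int => t /pq ->. Qed.

Lemma eq_contour x0 x1 y0 y1 f g : x0 <= x1 -> y0 <= y1 ->
  (forall z, on_edge x0 x1 y0 y1 z -> f z = g z) ->
  contour x0 x1 y0 y1 f = contour x0 x1 y0 y1 g.
Proof.
move=> x01 y01 fg; rewrite /contour.
by congr (_ - _ + 'i * (_ - _)); apply: eq_cseg_int => t ht; apply: fg; split;
  rewrite ?ht; rewrite /in_rect /= ?lexx ?x01 ?y01 ?ht; auto.
Qed.

Lemma contour_bound x0 x1 y0 y1 f e : edge_continuous x0 x1 y0 y1 f ->
  x0 <= x1 -> y0 <= y1 -> (forall z, on_edge x0 x1 y0 y1 z -> normc (f z) <= e) ->
  normc (contour x0 x1 y0 y1 f) <= 4 * e * ((x1 - x0) + (y1 - y0)).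
Proof.
move=> [f1 f2 f3 f4] x01 y01 h.
have st (l u : R) (g : R -> R[i]) : continuous g -> l <= u ->
   (forall t, l <= t <= u -> normc (g t) <= e) ->
   normc (cseg_int l u g) <= 2 * e * (u - l).
  move=> cg lu hg; have := @cseg_int_close _ l u 0 e g cg lu.
  by rewrite mulr0 subr0; apply => t /hg; rewrite subr0.
have hh p q r s : normc p <= r -> normc q <= s -> normc (p - q : R[i]) <= r + s.
  by move=> ? ?; apply: (le_trans (le_normcD _ _)); rewrite normcN lerD.
have -> : 4 * e * ((x1 - x0) + (y1 - y0)) =
   (2 * e * (x1 - x0) + 2 * e * (x1 - x0)) + (2 * e * (y1 - y0) + 2 * e * (y1 - y0)).
  by ring.
apply: (le_trans (le_normcD _ _)); rewrite Normc.normcM.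
have -> : normc 'i = 1 :> R by rewrite /= expr0n expr1n add0r sqrtr1.
rewrite mul1r; apply: lerD; apply: hh.
- by apply: (st _ _ _ f1 x01) => t ht; apply: h; split;
    rewrite /in_rect /= ?lexx ?x01 ?y01 ?ht; auto.
- by apply: (st _ _ _ f2 x01) => t ht; apply: h; split;
    rewrite /in_rect /= ?lexx ?x01 ?y01 ?ht; auto.
- by apply: (st _ _ _ f4 y01) => t ht; apply: h; split;
    rewrite /in_rect /= ?lexx ?x01 ?y01 ?ht; auto.
- by apply: (st _ _ _ f3 y01) => t ht; apply: h; split;
    rewrite /in_rect /= ?lexx ?x01 ?y01 ?ht; auto.
Qed.

Lemma continuous_normc_comp (g : R -> R[i]) : continuous g ->
  continuous (fun t => normc (g t)).
Proof.
move=> cg t; apply/cvgrPdist_lt => e e0.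
have /cvg_cplxP/(_ e e0) := cg t; apply: filterS => s; apply: le_lt_trans.
have tri (p q : R[i]) : normc p - normc q <= normc (p - q).
  by rewrite lerBlDr; have := le_normcD (p - q) q; rewrite subrK.
rewrite ler_norml lerBlDr -lerBlDl.
have := tri (g s) (g t); have := tri (g t) (g s).
by rewrite -[normc (g s - g t)]normcN opprB => ? ?; apply/andP; split; lra.
Qed.

Lemma seg_bounded (l u : R) (g : R -> R[i]) : continuous g -> l <= u ->
  exists M, forall t, l <= t <= u -> normc (g t) <= M.
Proof.
move=> cg lu; have cn := continuous_normc_comp cg.
have [c _ hc] := EVT_max lu (@continuous_subspaceT _ _ `[l, u] _ cn).
by exists (normc (g c)) => t ht; apply: hc; rewrite in_itv.
Qed.

Lemma kernel_edge_continuous x0 x1 y0 y1 b : x0 < Re b < x1 -> y0 < Im b < y1 ->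
  edge_continuous x0 x1 y0 y1 (fun z => (z - b)^-1).
Proof.
move=> /andP[xb bx] /andP[yb by_].
have cl : continuous_on_lines (fun z : R[i] => z - b).
  apply: continuous_lines => z; apply/(@cvg_cplxP _ _ _ (nbhs_filter z)) => e e0.
  have := near_normc z e0; apply: (@filterS _ (nbhs z) _) => w.
  by rewrite opprB addrA subrK.
case: cl => c1 c2.
split=> t; apply: cvgV; try exact: c1; try exact: c2.
- rewrite subr_eq0; apply/eqP => /(congr1 (@Im R)) /= E; move: yb; rewrite -E ltxx //.
- rewrite subr_eq0; apply/eqP => /(congr1 (@Im R)) /= E; move: by_; rewrite -E ltxx //.
- rewrite subr_eq0; apply/eqP => /(congr1 (@Re R)) /= E; move: xb; rewrite -E ltxx //.
- rewrite subr_eq0; apply/eqP => /(congr1 (@Re R)) /= E; move: bx; rewrite -E ltxx //.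
Qed.

Lemma invcE (p q : R) : (p +i* q)^-1 =
  (p / (p ^+ 2 + q ^+ 2)) +i* (- (q / (p ^+ 2 + q ^+ 2))) :> R[i].
Proof. by []. Qed.

Lemma Im_contour x0 x1 y0 y1 f :
  Im (contour x0 x1 y0 y1 f) =
  seg_int x0 x1 (fun x => Im (f (x +i* y0))) - seg_int x0 x1 (fun x => Im (f (x +i* y1)))
  + (seg_int y0 y1 (fun y => Re (f (x1 +i* y))) - seg_int y0 y1 (fun y => Re (f (x0 +i* y)))).
Proof. by rewrite /contour /cseg_int /=; ring. Qed.

(** The winding integral equals [2 i pi], but it is enough to know that it
    stays away from zero, and this follows from the fact that its imaginary
    part has a positive integrand on every side. *)
Lemma kernel_contour_ge x0 x1 y0 y1 b (r m : R) : 0 < r -> r <= m ->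
  x0 + r <= Re b <= x1 - r -> y0 + r <= Im b <= y1 - r ->
  x1 - x0 <= m -> y1 - y0 <= m ->
  r ^+ 2 / m ^+ 2 <= normc (contour x0 x1 y0 y1 (fun z => (z - b)^-1)).
Proof.
move=> r0 rm /andP[xb bx] /andP[yb by_] xm ym.
have m0 : 0 < m by lra.
have [k1 k2 k3 k4] : edge_continuous x0 x1 y0 y1 (fun z => (z - b)^-1).
  by apply: kernel_edge_continuous; apply/andP; split; lra.
apply: (le_trans _ (normc_Im _)); apply: (le_trans _ (ler_norm _)).
rewrite Im_contour; case: b xb bx yb by_ k1 k2 k3 k4 => u v /= xb bx yb by_ k1 k2 k3 k4.
pose K := r / (2 * m ^+ 2).
have K0 : 0 <= K by rewrite divr_ge0 ?mulr_ge0 ?exprn_ge0 //; lra.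
have est (p q : R) : r <= p -> `|p| <= m -> `|q| <= m -> K <= p / (p ^+ 2 + q ^+ 2).
  move=> rp pm qm.
  have p0 : 0 < p by lra.
  have D0 : 0 < p ^+ 2 + q ^+ 2 by rewrite ltr_pwDl ?sqr_ge0 // exprn_gt0.
  have D1 : p ^+ 2 + q ^+ 2 <= 2 * m ^+ 2.
    have : p ^+ 2 <= m ^+ 2 by rewrite -[p ^+ 2]real_normK ?num_real // lerXn2r // nnegrE // ltW.
    have : q ^+ 2 <= m ^+ 2 by rewrite -[q ^+ 2]real_normK ?num_real // lerXn2r // nnegrE // ltW.
    by lra.
  rewrite /K; apply: ler_pM => //; [exact: ltW| |].
    by rewrite invr_ge0 mulr_ge0 ?exprn_ge0 // ltW.
  by rewrite lef_pV2 // posrE // mulr_gt0 ?exprn_gt0.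
have nb p : - m <= p -> p <= m -> `|p| <= m by move=> ? ?; rewrite ler_norml; apply/andP.
have opp (l w : R) (g : R -> R) : continuous g ->
    - seg_int l w g = seg_int l w (fun t => - 1 * g t + (cst 0) t).
  move=> cg; rewrite (@seg_int_lin _ l w (-1) g (cst 0)) //; last exact: cst_continuous.
  by rewrite mulN1r /seg_int Rintegral_cst //= mul0r addr0.
have nonneg (l w : R) (g : R -> R) : continuous g -> l <= w ->
    (forall t, l <= t <= w -> K <= g t) -> K * (w - l) <= seg_int l w g.
  by move=> cg lw; exact: seg_int_ge.
have nonnegN (l w : R) (g : R -> R) : continuous g -> l <= w ->
    (forall t, l <= t <= w -> K <= - g t) -> K * (w - l) <= - seg_int l w g.
  move=> cg lw hg; rewrite opp //; apply: seg_int_ge => // t.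
    apply: cvgD; last exact: cvg_cst.
    by apply: cvgM; [exact: cvg_cst|exact: cg].
  by move=> /hg; rewrite mulN1r addr0.
have i1 := continuous_Im_comp k1; have i2 := continuous_Im_comp k2.
have i3 := continuous_Re_comp k3; have i4 := continuous_Re_comp k4.
have e1 : K * (x1 - x0) <= seg_int x0 x1 (fun x => Im ((x +i* y0 - (u +i* v))^-1)).
  apply: nonneg => // [|t /andP[? ?]]; first lra.
  rewrite -[x in Im x^-1]/((t - u) +i* (y0 - v)) invcE /=.
  rewrite -mulNr [X in _ / X]addrC -(sqrrN (y0 - v));
    apply: est; last apply: nb; first lra; try (apply: nb); lra.
have e2 : K * (x1 - x0) <= - seg_int x0 x1 (fun x => Im ((x +i* y1 - (u +i* v))^-1)).
  apply: nonnegN => // [|t /andP[? ?]]; first lra.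
  rewrite -[x in Im x^-1]/((t - u) +i* (y1 - v)) invcE /= opprK.
  by rewrite [X in _ / X]addrC;
    apply: est; last apply: nb; first lra; try (apply: nb); lra.
have e3 : K * (y1 - y0) <= seg_int y0 y1 (fun y => Re ((x1 +i* y - (u +i* v))^-1)).
  apply: nonneg => // [|t /andP[? ?]]; first lra.
  rewrite -[x in Re x^-1]/((x1 - u) +i* (t - v)) invcE /=.
  by
    apply: est; last apply: nb; first lra; try (apply: nb); lra.
have e4 : K * (y1 - y0) <= - seg_int y0 y1 (fun y => Re ((x0 +i* y - (u +i* v))^-1)).
  apply: nonnegN => // [|t /andP[? ?]]; first lra.
  rewrite -[x in Re x^-1]/((x0 - u) +i* (t - v)) invcE /=.
  by rewrite -mulNr -(sqrrN (x0 - u));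
    apply: est; last apply: nb; first lra; try (apply: nb); lra.
have -> : r ^+ 2 / m ^+ 2 = K * (2 * r).
  by rewrite /K; field; lra.
have a1 : K * (2 * r) <= K * (x1 - x0) by apply: ler_wpM2l => //; lra.
have a2 : 0 <= K * (y1 - y0) by apply: mulr_ge0 => //; lra.
have a3 : 0 <= K * (x1 - x0) by apply: mulr_ge0 => //; lra.
by lra.
Qed.

End ContourEstimates.

(** * Cauchy's formula and Lipschitz bounds *)

Section CauchyEstimate.
Context {R : realType}.
Implicit Types (e t : R) (b c z w h : R[i]) (f g : R[i] -> R[i]).

Lemma edge_continuousM x0 x1 y0 y1 f g : continuous f ->
  edge_continuous x0 x1 y0 y1 g ->
  edge_continuous x0 x1 y0 y1 (fun z => f z * g z).
Proof.
move=> /continuous_lines [cx cy] [g1 g2 g3 g4].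
by split=> t; apply: cvgM; [exact: cx|exact: g1|exact: cx|exact: g2
  |exact: cy|exact: g3|exact: cy|exact: g4].
Qed.

Lemma edge_continuous_lin x0 x1 y0 y1 c f g :
  edge_continuous x0 x1 y0 y1 f -> edge_continuous x0 x1 y0 y1 g ->
  edge_continuous x0 x1 y0 y1 (fun z => c * f z + g z).
Proof.
move=> [f1 f2 f3 f4] [g1 g2 g3 g4].
split=> t.
- by apply: cvgD; [apply: cvgM; [exact: cvg_cst|exact: f1]|exact: g1].
- by apply: cvgD; [apply: cvgM; [exact: cvg_cst|exact: f2]|exact: g2].
- by apply: cvgD; [apply: cvgM; [exact: cvg_cst|exact: f3]|exact: g3].
- by apply: cvgD; [apply: cvgM; [exact: cvg_cst|exact: f4]|exact: g4].
Qed.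

(** Cauchy's formula with the winding integral left unevaluated: integrate the
    difference quotient of [f] at [b], whose only possible singularity is
    removable. *)
Lemma cauchy_formula x0 x1 y0 y1 f b : x0 < Re b < x1 -> y0 < Im b < y1 ->
  (forall z, in_rect x0 x1 y0 y1 z -> derivable f z 1) ->
  contour x0 x1 y0 y1 (fun z => f (cclamp x0 x1 y0 y1 z) * (z - b)^-1) =
  f b * contour x0 x1 y0 y1 (fun z => (z - b)^-1).
Proof.
move=> xb yb df; have /andP[xb1 xb2] := xb; have /andP[yb1 yb2] := yb.
have x01 : x0 <= x1 by lra.
have y01 : y0 <= y1 by lra.
have bin : in_rect x0 x1 y0 y1 b by split; apply/andP; split; lra.
have ke := kernel_edge_continuous xb yb.
pose F z := f (cclamp x0 x1 y0 y1 z).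
have cF : continuous F.
  by apply: cont_at_clamp => // z /df /derivable_has_cderiv /has_cderiv_cont_at.
pose q z := slope f b (cclamp x0 x1 y0 y1 z).
have cq : continuous q.
  by apply: cont_at_clamp => // z /df; apply: slope_cont_at; exact: df.
have q0 : contour x0 x1 y0 y1 q = 0.
  apply: (goursat_removable cq xb yb) => w win wb.
  have [c hc] := slope_cderiv wb (df _ win).
  exists c => e e0; have [d d0 hd] := hc _ e0.
  exists d => // w' w'in hw'; rewrite /q !cclamp_id //.
  have := hd _ hw'; rewrite vnorm_normc -[_ *: c]/(_ * c) (mulrC _ c).
  by have -> : w + (w' - w) = w' by rewrite addrC subrK.
have qe z : on_edge x0 x1 y0 y1 z ->
    q z = (- f b) * (z - b)^-1 + F z * (z - b)^-1.
  move=> [zin ze]; rewrite /q /F !cclamp_id // /slope.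
  have -> : (z == b) = false.
    apply/negP => /eqP E; move: ze xb1 xb2 yb1 yb2; rewrite E.
    by case=> [->|[->|[->|->]]]; rewrite ltxx.
  by rewrite -mulrDl addrC.
move: q0; rewrite (eq_contour x01 y01 qe).
rewrite (contour_lin (- f b) ke (edge_continuousM cF ke)).
by move/eqP; rewrite mulNr addrC subr_eq0 => /eqP.
Qed.

Lemma normc_edge_ge x0 x1 y0 y1 (r : R) b z : 0 <= r ->
  x0 + r <= Re b <= x1 - r -> y0 + r <= Im b <= y1 - r ->
  on_edge x0 x1 y0 y1 z -> r <= normc (z - b).
Proof.
move=> r0 /andP[xb bx] /andP[yb by_] [_ ze].
have hR : `|Re z - Re b| <= normc (z - b) by have := normc_Re (z - b); rewrite raddfB.
have hI : `|Im z - Im b| <= normc (z - b) by have := normc_Im (z - b); rewrite raddfB.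
have p (u : R) : u <= `|u| by exact: ler_norm.
have n (u : R) : - u <= `|u| by rewrite -normrN ler_norm.
have := p (Re z - Re b); have := n (Re z - Re b).
have := p (Im z - Im b); have := n (Im z - Im b).
by case: ze => [|[|[|]]] E; rewrite E in hR hI *; lra.
Qed.

(** A Cauchy estimate. By [cauchy_formula], [(f a - f b) * J b] is the contour
    integral of [(F - f a) * (k a - k b)], where [k] is the Cauchy kernel and
    [J] its integral; the kernels differ by [O(|a - b|)] on the boundary and
    [J b] is bounded below. One thin rectangle around the segment serves for
    all [a] and [b]. *)
Lemma holomorphic_lipschitz f (s : R) : 0 <= s -> s < 1 ->
  (forall z, normc z < 1 -> derivable f z 1) ->
  exists2 L : R, 0 <= L & forall a b : R, 0 <= a <= s -> 0 <= b <= s ->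
    normc (f a%:C - f b%:C) <= L * `|a - b|.
Proof.
move=> s0 s1 df.
(* with this margin the rectangle around the segment stays in the disc, as
   its corners have squared norm at most [(1 + s ^+ 2) / 2] *)
pose r := (1 - s) / 2.
have r0 : 0 < r by rewrite divr_gt0 // subr_gt0.
have r1 : r <= 1 / 2 by rewrite /r; lra.
pose x0 := - r; pose x1 := s + r; pose y0 := - r; pose y1 := r.
have x01 : x0 <= x1 by rewrite /x0 /x1; lra.
have y01 : y0 <= y1 by rewrite /y0 /y1; lra.
have inD z : in_rect x0 x1 y0 y1 z -> normc z < 1.
  case: z => u v [/= /andP[u1 u2] /andP[v1 v2]].
  rewrite -[ltRHS]sqrtr1 ltr_sqrt //.
  rewrite /x0 /x1 /y0 /y1 in u1 u2 v1 v2.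
  have hu : u ^+ 2 <= (s + r) ^+ 2 by nra.
  have hv : v ^+ 2 <= r ^+ 2 by nra.
  have : (s + r) ^+ 2 + r ^+ 2 < 1 by rewrite /r; nra.
  lra.
have dfr z : in_rect x0 x1 y0 y1 z -> derivable f z 1 by move=> /inD; exact: df.
pose F z := f (cclamp x0 x1 y0 y1 z).
have cF : continuous F.
  by apply: cont_at_clamp => // z /dfr /derivable_has_cderiv /has_cderiv_cont_at.
have [cFx cFy] := continuous_lines cF.
have [M1 h1] := seg_bounded (cFx y0) x01.
have [M2 h2] := seg_bounded (cFx y1) x01.
have [M3 h3] := seg_bounded (cFy x0) y01.
have [M4 h4] := seg_bounded (cFy x1) y01.
have [M5 h5] := seg_bounded (cFx 0) s0.
pose M := `|M1| + `|M2| + `|M3| + `|M4| + `|M5|.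
have n1 := normr_ge0 M1; have n2 := normr_ge0 M2; have n3 := normr_ge0 M3.
have n4 := normr_ge0 M4; have n5 := normr_ge0 M5.
have p1 := ler_norm M1; have p2 := ler_norm M2; have p3 := ler_norm M3.
have p4 := ler_norm M4; have p5 := ler_norm M5.
have M0 : 0 <= M by rewrite /M; lra.
have FM z : on_edge x0 x1 y0 y1 z -> normc (F z) <= M.
  case: z => u v [[/= hu hv] [E|[E|[E|E]]]]; rewrite E in hu hv *.
  - by apply: (le_trans (h3 _ hv)); rewrite /M; lra.
  - by apply: (le_trans (h4 _ hv)); rewrite /M; lra.
  - by apply: (le_trans (h1 _ hu)); rewrite /M; lra.
  - by apply: (le_trans (h2 _ hu)); rewrite /M; lra.
have realin (a : R) : 0 <= a <= s -> in_rect x0 x1 y0 y1 a%:C.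
  by move=> /andP[? ?]; split; apply/andP; split; rewrite /= /x0 /x1 /y0 /y1; lra.
have fM (a : R) : 0 <= a <= s -> normc (f a%:C) <= M.
  move=> ha; have := h5 _ ha; rewrite /F cclamp_id; last exact: realin.
  by move=> h; apply: (le_trans h); rewrite /M; lra.
(* an upper bound for the sides of the rectangle *)
pose m : R := 2.
pose per := (x1 - x0) + (y1 - y0).
pose B := r ^+ 2 / m ^+ 2.
have B0 : 0 < B by rewrite divr_gt0 // exprn_gt0.
pose L := 4 * (2 * M / r ^+ 2) * per / B.
have per0 : 0 <= per by rewrite /per; lra.
exists L.
  apply: divr_ge0; last exact: ltW.
  apply: mulr_ge0 => //; apply: mulr_ge0 => //.
  by apply: divr_ge0; [exact: mulr_ge0|exact/exprn_ge0/ltW].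
move=> a b ha hb.
have xin (c : R) : 0 <= c <= s -> x0 + r <= Re c%:C <= x1 - r.
  by move=> /andP[? ?]; apply/andP; split; rewrite /= /x0 /x1; lra.
have yin (c : R) : 0 <= c <= s -> y0 + r <= Im c%:C <= y1 - r.
  by move=> /andP[? ?]; apply/andP; split; rewrite /= /y0 /y1; lra.
have xin' (c : R) : 0 <= c <= s -> x0 < Re c%:C < x1.
  by move=> /andP[? ?]; apply/andP; split; rewrite /= /x0 /x1; lra.
have yin' (c : R) : 0 <= c <= s -> y0 < Im c%:C < y1.
  by move=> /andP[? ?]; apply/andP; split; rewrite /= /y0 /y1; lra.
pose k (c : R) z : R[i] := (z - c%:C)^-1.
have ke (c : R) : 0 <= c <= s -> edge_continuous x0 x1 y0 y1 (k c).
  by move=> hc; apply: kernel_edge_continuous; [exact: xin'|exact: yin'].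
pose J (c : R) := contour x0 x1 y0 y1 (k c).
pose P (c : R) := contour x0 x1 y0 y1 (fun z => F z * k c z).
have PJ (c : R) : 0 <= c <= s -> P c = f c%:C * J c.
  by move=> hc; apply: cauchy_formula => //; [exact: xin'|exact: yin'].
have Fke (c : R) : 0 <= c <= s -> edge_continuous x0 x1 y0 y1 (fun z => F z * k c z).
  by move=> hc; apply: edge_continuousM => //; exact: ke.
pose G z := -1 * (F z * k b z) + ((- f a%:C) * k a z + (f a%:C * k b z + F z * k a z)).
have Gc1 := edge_continuous_lin (f a%:C) (ke b hb) (Fke a ha).
have Gc2 := edge_continuous_lin (- f a%:C) (ke a ha) Gc1.
have Gc : edge_continuous x0 x1 y0 y1 G.
  exact: (edge_continuous_lin (-1) (Fke b hb) Gc2).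
have GE : contour x0 x1 y0 y1 G = (f a%:C - f b%:C) * J b.
  rewrite /G (contour_lin _ (Fke b hb) Gc2) (contour_lin _ (ke a ha) Gc1).
  rewrite (contour_lin _ (ke b hb) (Fke a ha)) -/(P b) -/(P a) -/(J a) -/(J b).
  by rewrite !PJ //; ring.
have Gb z : on_edge x0 x1 y0 y1 z -> normc (G z) <= 2 * M / r ^+ 2 * `|a - b|.
  move=> ze.
  have za := normc_edge_ge (ltW r0) (xin _ ha) (yin _ ha) ze.
  have zb := normc_edge_ge (ltW r0) (xin _ hb) (yin _ hb) ze.
  have za0 : z - a%:C != 0.
    by apply/eqP => E; move: za; rewrite E Normc.normc0 leNgt r0.
  have zb0 : z - b%:C != 0.
    by apply/eqP => E; move: zb; rewrite E Normc.normc0 leNgt r0.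
  have -> : G z = (F z - f a%:C) * ((a - b)%:C * (k a z * k b z)).
    by rewrite /G /k rmorphB /=; field; rewrite za0 zb0.
  rewrite !Normc.normcM normc_real /k !Normc.normcV.
  have -> : 2 * M / r ^+ 2 * `|a - b| = (2 * M) * (`|a - b| * (r^-1 * r^-1)).
    by field; rewrite gt_eqF.
  have i0 c' : 0 <= (normc (z - c'))^-1 by rewrite invr_ge0 normc_ge0.
  apply: ler_pM; rewrite ?normc_ge0 ?mulr_ge0 //.
    have -> : 2 * M = M + M by ring.
    by apply: (le_trans (le_normcD _ _)); rewrite normcN lerD ?FM ?fM.
  apply: ler_wpM2l => //; apply: ler_pM => //.
    by rewrite lef_pV2 // posrE (lt_le_trans r0).
  by rewrite lef_pV2 // posrE (lt_le_trans r0).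
have := contour_bound Gc x01 y01 Gb; rewrite GE Normc.normcM -/per => hup.
have hlow : B <= normc (J b).
  apply: kernel_contour_ge => //; [rewrite /m; lra|exact: xin|exact: yin| |];
    rewrite /m /x0 /x1 /y0 /y1; lra.
rewrite /L mulrAC ler_pdivlMr //.
apply: (le_trans (ler_wpM2l (normc_ge0 _) hlow)).
apply: (le_trans hup); rewrite le_eqVlt; apply/orP; left; apply/eqP; ring.
Qed.

End CauchyEstimate.

(** * The hyperbolic tangent *)

Section Tanh.
Context {R : realType}.
Implicit Types (s t u x y : R).

(** The hyperbolic tangent, which turns arclength for the Poincare distance
    into the radial coordinate of the disc. *)
Definition tanh t : R := 1 - 2 / (expR (2 * t) + 1).

Let E t : R := expR (2 * t).
Let E0 t : 0 < E t. Proof. exact: expR_gt0. Qed.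

Lemma tanhE t : tanh t = (E t - 1) / (E t + 1).
Proof. by rewrite /tanh -/(E t); field; rewrite gt_eqF // addr_gt0. Qed.

Lemma tanh0 : tanh 0 = 0.
Proof. by rewrite tanhE /E mulr0 expR0 subrr mul0r. Qed.

Lemma tanhN t : tanh (- t) = - tanh t.
Proof.
rewrite !tanhE /E mulrN expRN -/(E t); field.
by rewrite !gt_eqF // ?addr_gt0.
Qed.

Lemma tanh_lt1 t : tanh t < 1.
Proof. by rewrite /tanh ltrBlDr ltrDl divr_gt0 // addr_gt0 // expR_gt0. Qed.

Lemma tanh_gtN1 t : -1 < tanh t.
Proof. by have := tanh_lt1 (- t); rewrite tanhN ltrNl. Qed.

Lemma normr_tanh t : `|tanh t| < 1.
Proof. by rewrite ltr_norml tanh_lt1 tanh_gtN1. Qed.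

Lemma tanhD_den s t : 1 + tanh s * tanh t != 0.
Proof.
have := tanh_lt1 s; have := tanh_gtN1 s; have := tanh_lt1 t; have := tanh_gtN1 t.
move=> *; rewrite gt_eqF //; nra.
Qed.

Lemma tanhD s t : tanh (s + t) = (tanh s + tanh t) / (1 + tanh s * tanh t).
Proof.
have := tanhD_den s t.
rewrite !tanhE /E mulrDr expRD -/(E s) -/(E t).
have := E0 s; have := E0 t; move: (E s) (E t) => p q q0 p0 nz.
have pq : 0 < p * q by exact: mulr_gt0.
have d : (p + 1) * (q + 1) + (p - 1) * (q - 1) != 0 by rewrite gt_eqF //; nra.
field; rewrite d /= !gt_eqF //; lra.
Qed.

Lemma ltr_tanh s t : s < t -> tanh s < tanh t.
Proof.
move=> st; rewrite /tanh ltrD2l ltrN2 ltr_pM2l // ltf_pV2 ?posrE ?addr_gt0 ?expR_gt0 //.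
by rewrite ltrD2r ltr_expR ltr_pM2l.
Qed.

Lemma tanh_ge0 t : 0 <= t -> 0 <= tanh t.
Proof. by rewrite le_eqVlt => /predU1P[<-|/ltr_tanh]; rewrite tanh0 // => /ltW. Qed.

Lemma tanh_gt0 t : 0 < t -> 0 < tanh t.
Proof. by move=> /ltr_tanh; rewrite tanh0. Qed.

Lemma is_derive_tanh t : is_derive t 1 tanh (1 - tanh t ^+ 2).
Proof.
have E1 : expR (2 * t) + 1 != 0 by rewrite gt_eqF // addr_gt0 // expR_gt0.
have dE : is_derive t 1 (fun s : R => expR (2 * s) + 1) (2 * expR (2 * t)).
  by apply: is_derive_eq; rewrite /= ?addr0 /GRing.scale /= mulr1 mulrC.
have dI : is_derive t 1 (fun s : R => (expR (2 * s) + 1)^-1)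
    (- (expR (2 * t) + 1) ^- 2 *: (2 * expR (2 * t))).
  apply: DeriveDef; first exact: derivableV.
  by rewrite deriveV // derive_val.
have thf : tanh = cst 1 - (2 \*: (fun s : R => (expR (2 * s) + 1)^-1)).
  by apply/funext => s.
rewrite {1}thf; apply: is_derive_eq; rewrite /= sub0r tanhE -/(E t) /GRing.scale /=.
by field; rewrite gt_eqF // addr_gt0.
Qed.

Definition artanh x : R := 2^-1 * ln ((1 + x) / (1 - x)).

Lemma artanh_tanh s : artanh (tanh s) = s.
Proof.
rewrite /artanh.
have -> : (1 + tanh s) / (1 - tanh s) = E s.
  rewrite tanhE; field; have := E0 s => ?; rewrite !gt_eqF //=; lra.
by rewrite expRK mulrA mulVf ?mul1r.
Qed.

Lemma tanh_artanh x : -1 < x < 1 -> tanh (artanh x) = x.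
Proof.
move=> /andP[x1 x2]; rewrite tanhE /E /artanh mulrA divff // mul1r lnK; last first.
  by rewrite posrE divr_gt0 //; lra.
by field; rewrite !gt_eqF //; lra.
Qed.

Lemma artanh0 : artanh 0 = 0.
Proof. by rewrite /artanh addr0 subr0 divr1 ln1 mulr0. Qed.

Lemma ler_artanh x y : -1 < x -> x <= y -> y < 1 -> artanh x <= artanh y.
Proof.
move=> x1 xy y1; rewrite leNgt; apply/negP => /ltr_tanh.
by rewrite !tanh_artanh ?ltNge ?xy //; apply/andP; split; lra.
Qed.

Lemma ltr_artanh x y : -1 < x -> x < y -> y < 1 -> artanh x < artanh y.
Proof.
move=> x1 xy y1; rewrite lt_neqAle ler_artanh ?(ltW xy) // andbT.
apply/eqP => /(congr1 tanh); rewrite !tanh_artanh => [E'||].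
- by rewrite E' ltxx in xy.
- by apply/andP; split; lra.
- by apply/andP; split; lra.
Qed.

Lemma artanh_ge0 x : 0 <= x -> x < 1 -> 0 <= artanh x.
Proof. by move=> ? ?; rewrite -artanh0; apply: ler_artanh => //; lra. Qed.

Lemma artanh_le x : 0 <= x -> x < 1 -> artanh x <= x / (1 - x).
Proof.
move=> x0 x1; rewrite /artanh.
have -> : (1 + x) / (1 - x) = 1 + 2 * (x / (1 - x)).
  by field; rewrite gt_eqF //; lra.
rewrite mulrC ler_pdivrMr // mulrC.
apply: le_ln1Dx; apply: (lt_le_trans (ltrN10 _)).
by rewrite mulr_ge0 // divr_ge0 //; lra.
Qed.

(** The function [1 - tanh ^+ 2] is the derivative of [tanh]: this lower bound
    is how an exponentially small error gets absorbed by a bounded primitive.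
    *)
Lemma tanh_sech u : expR (- (2 * `|u|)) <= 1 - tanh u ^+ 2.
Proof.
wlog u0 : u / 0 <= u.
  move=> h; have [/h //|/ltW u0] := leP 0 u.
  by have := h (- u); rewrite normrN tanhN sqrrN oppr_ge0; exact.
rewrite ger0_norm // expRN tanhE -/(E u).
have e1 : 1 <= E u by rewrite -expR0 ler_expR mulr_ge0.
move: (E u) e1 => e e1.
have -> : 1 - ((e - 1) / (e + 1)) ^+ 2 = 4 * e / (e + 1) ^+ 2.
  by field; rewrite gt_eqF //; lra.
rewrite ler_pdivlMr; last by apply: exprn_gt0; lra.
rewrite mulrC ler_pdivrMr; last lra.
nra.
Qed.

End Tanh.

(** * Moebius maps and the Kobayashi distance *)

Section Moebius.
Context {R : realType}.
Implicit Types (a b z w : R[i]) (s t : R).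

(** The automorphism of the disc that maps [0] to [a]. *)
Definition moebius a z : R[i] := (z + a) / (1 + conjc a * z).

Lemma sqr_normc_def z : normc z ^+ 2 = Re z ^+ 2 + Im z ^+ 2.
Proof. by case: z => u v /=; rewrite sqr_sqrtr // addr_ge0 ?sqr_ge0. Qed.

Lemma normc_lt1 z : (normc z < 1) = (Re z ^+ 2 + Im z ^+ 2 < 1).
Proof. by rewrite -sqr_normc_def -[RHS]/(_ < 1) expr_lt1 // normc_ge0. Qed.

Lemma normc_conj z : normc (conjc z) = normc z.
Proof. by case: z => p q /=; rewrite sqrrN. Qed.

Lemma conjc_subM a b : conjc (1 - conjc b * a) = 1 - conjc a * b.
Proof.
by case: a b => [p q] [u v]; apply/eqP; rewrite eq_complex /=;
  apply/andP; split; apply/eqP; ring.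
Qed.

Lemma moebius_den a z : normc a < 1 -> normc z < 1 -> 1 + conjc a * z != 0.
Proof.
move=> ha hz; apply/eqP => E.
have : normc (conjc a * z) < 1.
  rewrite Normc.normcM normc_conj.
  have := normc_ge0 a; have := normc_ge0 z; nra.
have -> : conjc a * z = -1 by apply/eqP; rewrite -subr_eq0 opprK addrC E.
by rewrite normcN Normc.normc1 ltxx.
Qed.

Lemma moebius_disc a z : normc a < 1 -> normc z < 1 -> normc (moebius a z) < 1.
Proof.
move=> ha hz; have d0 := moebius_den ha hz.
rewrite /moebius Normc.normcM Normc.normcV ltr_pdivrMr ?normc_gt0 // mul1r.
rewrite -(@ltr_pXn2r _ 2) // ?nnegrE ?normc_ge0 // !sqr_normc_def.
move: ha hz; rewrite !normc_lt1; case: a {d0} => p q; case: z => x y /= h1 h2.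
have : 0 < (1 - (p ^+ 2 + q ^+ 2)) * (1 - (x ^+ 2 + y ^+ 2)).
  by apply: mulr_gt0; lra.
by nra.
Qed.

Lemma moebius_inv a b : normc a < 1 -> normc b < 1 ->
  moebius a (moebius (- a) b) = b.
Proof.
move=> ha hb; rewrite /moebius.
have hNa : normc (- a) < 1 by rewrite normcN.
have d1 := moebius_den hNa hb.
have d2 := moebius_den ha (moebius_disc hNa hb).
have cN : conjc (- a) = - conjc a by case: (a).
rewrite /moebius in d2; rewrite cN mulNr in d1 d2 *.
have d3 := moebius_den hNa ha; rewrite cN mulNr in d3.
move: (conjc a) d1 d2 d3 => c d1 d2 d3.
have E : 1 + c * ((b - a) / (1 - c * b)) = (1 - c * a) / (1 - c * b).
  by field.
rewrite E; field; rewrite d1 d3 //.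
Qed.

Lemma moebius0 a : moebius a 0 = a.
Proof. by rewrite /moebius add0r mulr0 addr0 divr1. Qed.

Lemma moebius_tanh s t : moebius (tanh s)%:C (tanh t)%:C = (tanh (s + t))%:C.
Proof.
rewrite /moebius conjc_real tanhD fmorph_div /=.
have -> : (1 + tanh s * tanh t)%:C = 1 + (tanh s)%:C * (tanh t)%:C.
  by apply/eqP; rewrite eq_complex /=; apply/andP; split; apply/eqP; ring.
by congr (_ / _); apply/eqP; rewrite eq_complex /= addr0 addrC !eqxx.
Qed.

Lemma derivable_moebius a z : normc a < 1 -> normc z < 1 ->
  derivable (moebius a) z 1.
Proof.
move=> ha hz.
have d0 := moebius_den ha hz.
have d1 : derivable (fun w : R[i] => w + a) z 1.
  exact: (@derivableD R[i] R[i] R[i] id (cst a) z 1 (@derivable_id _ _ _ _)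
    (@derivable_cst R[i] R[i] R[i] _ _ _)).
have d2 : derivable (fun w : R[i] => conjc a * w) z 1.
  exact: (@derivableM R[i] R[i] (cst (conjc a)) id z 1
    (@derivable_cst R[i] R[i] R[i] _ _ _) (@derivable_id _ _ _ _)).
have d3 : derivable (fun w : R[i] => 1 + conjc a * w) z 1.
  exact: (@derivableD R[i] R[i] R[i] (cst 1) _ z 1
    (@derivable_cst R[i] R[i] R[i] _ _ _) d2).
have d4 : derivable (fun w : R[i] => (1 + conjc a * w)^-1) z 1.
  by apply: (@derivableV R[i] R[i]).
exact: (@derivableM R[i] R[i] _ (fun w => (1 + conjc a * w)^-1) z 1 d1 d4).
Qed.

Lemma derivable_scale a z : derivable (fun w : R[i] => a * w) z 1.
Proof.
exact: (@derivableM R[i] R[i] (cst a) id z 1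
  (@derivable_cst R[i] R[i] R[i] _ _ _) (@derivable_id _ _ _ _)).
Qed.

Lemma normc_tanh t : normc (tanh t)%:C < 1.
Proof. by rewrite normc_real normr_tanh. Qed.

Lemma poincareE a b : poincare_distance a b = artanh (normc (moebius (- a) b)).
Proof.
rewrite /poincare_distance /artanh /moebius.
have -> : normc ((a - b) / (1 - conjc b * a)) = normc ((b - a) / (1 + conjc (- a) * b)).
  rewrite !Normc.normcM !Normc.normcV -(normcN (a - b)) opprB; congr (_ / _).
  have -> : conjc (- a) = - conjc a by case: (a).
  by rewrite mulNr -conjc_subM normc_conj.
by [].
Qed.

Lemma poincare_ge0 a b : normc a < 1 -> normc b < 1 -> 0 <= poincare_distance a b.
Proof.
move=> ha hb; rewrite poincareE artanh_ge0 ?normc_ge0 // moebius_disc // normcN //.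
Qed.

Lemma poincare_sym a b : poincare_distance a b = poincare_distance b a.
Proof.
rewrite /poincare_distance.
have -> // : normc ((a - b) / (1 - conjc b * a)) = normc ((b - a) / (1 - conjc a * b)).
rewrite !Normc.normcM !Normc.normcV -(normcN (a - b)) opprB; congr (_ / _).
by rewrite -conjc_subM normc_conj.
Qed.

Lemma poincare0 b : poincare_distance 0 b = artanh (normc b).
Proof. by rewrite poincareE /moebius oppr0 addr0 conjc0 mul0r addr0 divr1. Qed.

End Moebius.

Section KobayashiBasics.
Context {R : realType} {d : nat}.
Local Notation V := 'rV[R[i]]_d.
Implicit Types (D : set V) (x y z w : V) (f g : R[i] -> V) (s t : R).
Local Notation kd := kobayashi_distance.

Lemma holomorphic_disc_comp D f (g : R[i] -> R[i]) : holomorphic_disc D f ->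
  (forall a, normc a < 1 -> derivable g a 1 /\ normc (g a) < 1) ->
  holomorphic_disc D (fun a => f (g a)).
Proof.
move=> hf hg a ha; have [dg ga] := hg a ha; have [df Df] := hf (g a) ga.
split; last exact: Df.
have dg' := @derivable_has_cderiv R R[i] g a dg.
have df' := @derivable_has_cderiv R V f (g a) df.
have h := @has_cderiv_comp R V f g a _ _ dg' df'.
exact (@has_cderiv_derivable R V _ a _ h).
Qed.

Lemma holomorphic_disc_moebius D f a : holomorphic_disc D f -> normc a < 1 ->
  holomorphic_disc D (fun u => f (moebius a u)).
Proof.
move=> hf ha; apply: (@holomorphic_disc_comp D f (moebius a)) => // u hu.
by split; [exact: derivable_moebius|exact: moebius_disc].
Qed.

Lemma holomorphic_disc_scale D f a : holomorphic_disc D f -> normc a <= 1 ->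
  holomorphic_disc D (fun u => f (a * u)).
Proof.
move=> hf ha; apply: (@holomorphic_disc_comp D f (fun u => a * u)) => // u hu.
split; first exact: derivable_scale.
rewrite Normc.normcM; have := normc_ge0 a; have := normc_ge0 u; nra.
Qed.

Lemma sub_holomorphic_disc D D' f : D `<=` D' -> holomorphic_disc D f ->
  holomorphic_disc D' f.
Proof. by move=> DD hf a /hf [? /DD]. Qed.

(** The points lie on one analytic disc at hyperbolic distance [|s|], the
    first one at the centre. The sign of [s] is free, which lets a point of a
    path be linked both to its past and to its future. *)
Definition disc_link D x y s := exists f,
  [/\ holomorphic_disc D f, f 0 = x & f (tanh s)%:C = y].

Lemma disc_link_opp D x y s : disc_link D x y s -> disc_link D x y (- s).
Proof.
move=> [f [hf f0 fs]]; exists (fun u => f (-1 * u)).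
rewrite mulr0 mulN1r tanhN rmorphN opprK; split=> //.
by apply: holomorphic_disc_scale; rewrite // normcN Normc.normc1.
Qed.

Lemma disc_link_segment D f s t : holomorphic_disc D f ->
  disc_link D (f (tanh s)%:C) (f (tanh t)%:C) (t - s).
Proof.
move=> hf; exists (fun u => f (moebius (tanh s)%:C u)); split.
- by apply: holomorphic_disc_moebius => //; exact: normc_tanh.
- by rewrite moebius0.
- by rewrite moebius_tanh addrC subrK.
Qed.

(** A Moebius map followed by a rotation brings any pair of points of the disc
    to [0] and a point of the positive real axis. *)
Lemma poincare_disc_link D f a b : holomorphic_disc D f ->
  normc a < 1 -> normc b < 1 -> disc_link D (f a) (f b) (poincare_distance a b).
Proof.
move=> hf ha hb; have hNa : normc (- a) < 1 by rewrite normcN.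
pose m := moebius (- a) b; have m1 : normc m < 1 by exact: moebius_disc.
have [u u1 um] : exists2 u : R[i], normc u <= 1 & u * (normc m)%:C = m.
  have [m0|m0] := eqVneq m 0.
    by exists 1; rewrite ?Normc.normc1 // m0 Normc.normc0 mulr0.
  exists (m / (normc m)%:C); last first.
    by rewrite divfK // -[0]/(0%:C) (inj_eq (@complexI _)) gt_eqF ?normc_gt0.
  rewrite Normc.normcM Normc.normcV normc_real ger0_norm ?normc_ge0 //.
  by rewrite divff // gt_eqF ?normc_gt0.
exists (fun v => f (moebius a (u * v))); split.
- by apply: (holomorphic_disc_scale (holomorphic_disc_moebius hf ha)).
- by rewrite mulr0 moebius0.
- rewrite poincareE tanh_artanh -/m ?um ?moebius_inv //.
  by rewrite m1 (lt_le_trans _ (normc_ge0 _)).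
Qed.

(** The lengths over which [kobayashi_distance] takes an infimum. *)
Definition disc_chain D z w s := exists (n : nat) (f : nat -> R[i] -> V)
      (a b : nat -> R[i]),
    [/\ forall j, (j <= n)%N ->
          [/\ holomorphic_disc D (f j), unit_disc (a j) & unit_disc (b j)],
        f 0%N (a 0%N) = z,
        f n (b n) = w,
        forall j, (j < n)%N -> f j (b j) = f j.+1 (a j.+1)
      & s = \sum_(j < n.+1) poincare_distance (a j) (b j)].

Lemma kdE D z w : kd D z w = ereal_inf [set s%:E | s in disc_chain D z w].
Proof.
congr ereal_inf; apply/seteqP; split=> s.
  by move=> [n [f [a [b [h1 h2 h3 h4 ->]]]]]; eexists; last by []; exists n, f, a, b.
by move=> [r [n [f [a [b [h1 h2 h3 h4 ->]]]]] <-]; exists n, f, a, b.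
Qed.

Lemma disc_chain_ge0 D z w s : disc_chain D z w s -> 0 <= s.
Proof.
move=> [n [f [a [b [h _ _ _ ->]]]]]; apply: sumr_ge0 => j _.
by have [|_ ha hb] := h j; [rewrite -ltnS|exact: poincare_ge0].
Qed.

Lemma kd_ge0 D z w : (0 <= kd D z w)%E.
Proof.
rewrite kdE; apply: le_ereal_inf_tmp => _ [s hs <-].
by rewrite lee_fin; exact: disc_chain_ge0 hs.
Qed.

Lemma kd_le_chain D z w s : disc_chain D z w s -> (kd D z w <= s%:E)%E.
Proof. by move=> h; rewrite kdE; apply: ereal_inf_lbound; exists s. Qed.

Lemma kd_lt_chain D z w (e : \bar R) : (kd D z w < e)%E ->
  exists2 s, disc_chain D z w s & (s%:E < e)%E.
Proof.
by rewrite kdE => /ereal_inf_lt [_ [s hs <-] lt]; exists s.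
Qed.

Lemma disc_chain_cat D x y z s t : disc_chain D x y s -> disc_chain D y z t ->
  disc_chain D x z (s + t).
Proof.
move=> [n [f [a [b [h1 h2 h3 h4 ->]]]]] [m [g [p [q [k1 k2 k3 k4 ->]]]]].
pose pick (T : Type) (u v : nat -> T) j := if (j <= n)%N then u j else v (j - n.+1)%N.
exists (n.+1 + m)%N, (pick _ f g), (pick _ a p), (pick _ b q).
have pl (T : Type) (u v : nat -> T) j : (j <= n)%N -> pick T u v j = u j.
  by rewrite /pick => ->.
have pr (T : Type) (u v : nat -> T) j : pick T u v (n.+1 + j)%N = v j.
  by rewrite /pick leqNgt ltnS leq_addr /= addKn.
split.
- move=> j jnm; have [jn|nj] := leqP j n; first by rewrite !pl //; exact: h1.
  rewrite -(subnKC nj) !pr; apply: k1.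
  by rewrite leq_subLR.
- by rewrite !pl.
- by rewrite !pr.
- move=> j jnm; have [jn|nj] := ltnP j n.
    by rewrite !pl // 1?ltnW //; exact: h4.
  move: nj; rewrite leq_eqVlt => /predU1P[nj|nj].
    have pr0 (T : Type) (u v : nat -> T) : pick T u v n.+1 = v 0%N.
      by rewrite -(pr T u v 0%N) addn0.
    by rewrite -nj !(fun T u v => pl T u v n (leqnn n)) !pr0 h3 k2.
  rewrite -(subnKC nj) -addnS !pr; apply: k4.
  by rewrite ltn_subLR.
- rewrite -addnS big_split_ord /=; congr (_ + _); apply: eq_bigr => j _.
    by rewrite !pl // -ltnS.
  by rewrite !pr.
Qed.

Lemma disc_chain_sym D x y s : disc_chain D x y s -> disc_chain D y x s.
Proof.
move=> [n [f [a [b [h1 h2 h3 h4 ->]]]]].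
exists n, (fun j => f (n - j)%N), (fun j => b (n - j)%N), (fun j => a (n - j)%N).
split.
- by move=> j jn; have [? ? ?] := h1 _ (leq_subr j n).
- by rewrite subn0.
- by rewrite subnn.
- move=> j jn; rewrite [in RHS]h4; last by rewrite ltn_subrL (leq_ltn_trans _ jn).
  by rewrite -subSn.
- rewrite (reindex_inj rev_ord_inj) /=; apply: eq_bigr => j _.
  by rewrite subSS poincare_sym.
Qed.

Lemma kd_sym D x y : kd D x y = kd D y x.
Proof.
rewrite !kdE; congr ereal_inf; apply/seteqP.
by split=> _ [s /disc_chain_sym hs <-]; exists s.
Qed.

Lemma kd_triangle D x y z : (kd D x z <= kd D x y + kd D y z)%E.
Proof.
have [hx|hx] := leP +oo%E (kd D x y).
  move: hx; rewrite leye_eq => /eqP ->; rewrite addye ?leey //.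
  by rewrite gt_eqF // (lt_le_trans _ (kd_ge0 _ _ _)).
have [hy|hy] := leP +oo%E (kd D y z).
  move: hy; rewrite leye_eq => /eqP ->; rewrite addey ?leey //.
  by rewrite gt_eqF // (lt_le_trans _ (kd_ge0 _ _ _)).
have fx : kd D x y \is a fin_num by rewrite ge0_fin_numE // kd_ge0.
have fy : kd D y z \is a fin_num by rewrite ge0_fin_numE // kd_ge0.
rewrite -(fineK fx) -(fineK fy); apply/lee_addgt0Pr => e e0.
have [s hs sl] : exists2 s, disc_chain D x y s & (s%:E < (fine (kd D x y) + e / 2)%:E)%E.
  by apply: kd_lt_chain; rewrite EFinD fineK // lteDl // lte_fin divr_gt0.
have [t ht tl] : exists2 t, disc_chain D y z t & (t%:E < (fine (kd D y z) + e / 2)%:E)%E.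
  by apply: kd_lt_chain; rewrite EFinD fineK // lteDl // lte_fin divr_gt0.
apply: (le_trans (kd_le_chain (disc_chain_cat hs ht))).
by rewrite -!EFinD lee_fin; move: sl tl; rewrite !lte_fin; lra.
Qed.

Lemma kd_mono D D' x y : D `<=` D' -> (kd D' x y <= kd D x y)%E.
Proof.
move=> DD; rewrite !kdE; apply: le_ereal_inf => _ [s hs <-]; exists s => //.
move: hs => [n [f [a [b [h1 h2 h3 h4 ->]]]]]; exists n, f, a, b; split=> // j /h1.
by move=> [hf ? ?]; split=> //; exact: sub_holomorphic_disc hf.
Qed.

Lemma kd_le_poincare D f a b : holomorphic_disc D f -> normc a < 1 -> normc b < 1 ->
  (kd D (f a) (f b) <= (poincare_distance a b)%:E)%E.
Proof.
move=> hf ha hb; apply: kd_le_chain; exists 0%N, (fun=> f), (fun=> a), (fun=> b).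
by split=> //; rewrite big_ord1.
Qed.

Lemma kd_link D x y s : disc_link D x y s -> (kd D x y <= `|s|%:E)%E.
Proof.
wlog s0 : s / 0 <= s.
  move=> h hl; have [s0|/ltW s0] := leP 0 s; first exact: h.
  by rewrite -normrN; apply: h; [rewrite oppr_ge0|exact: disc_link_opp].
move=> [f [hf <- <-]].
have h0 : normc (0 : R[i]) < 1 by rewrite Normc.normc0.
apply: (le_trans (kd_le_poincare hf h0 (normc_tanh s))).
by rewrite poincare0 normc_real ger0_norm ?tanh_ge0 // artanh_tanh ger0_norm.
Qed.

End KobayashiBasics.

(** * Paths made of geodesics of discs *)

Section IntervalInduction.
Context {R : realType}.
Implicit Types (P : R -> R -> Prop) (a b s t u v w : R).

(** Real induction: a relation that is transitive and holds between each point
    and its neighbours on either side holds between the endpoints. It replaces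
    both subdivision and integration of infinitesimal inequalities along
    paths. *)
Lemma interval_chaining P a b : a <= b ->
  (forall u v w, a <= u -> u <= v -> v <= w -> w <= b -> P u v -> P v w -> P u w) ->
  (forall t, a <= t <= b -> exists2 eta : R, 0 < eta &
     forall s, a <= s <= b -> `|s - t| < eta ->
       (s <= t -> P s t) /\ (t <= s -> P t s)) ->
  P a b.
Proof.
move=> ab trP locP.
pose S := [set t | a <= t <= b /\ P a t].
have Paa : P a a.
  have [|e e0 h] := locP a; first by rewrite lexx.
  by have [|| h1 _] := h a; rewrite ?lexx ?subrr ?normr0 //; exact: h1.
have Sa : S a by split; rewrite ?lexx.
have ubS : ubound S b by move=> t [/andP[_ ?] _].
have hs : has_sup S by split; [exists a|exists b].
pose c := sup S.
have ac : a <= c by apply: ub_le_sup => //; exists b.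
have cb : c <= b by apply: ge_sup => //; exists a.
have [|e e0 h] := locP c; first by rewrite ac cb.
have Pac : P a c.
  have [t [/andP[at_ tb] Pat] ct] := sup_adherent e0 hs.
  have tc : t <= c by apply: ub_le_sup; [exists b|split; rewrite ?at_ ?tb].
  apply: (trP a t c) => //; apply: (proj1 (h t _ _)) => //; first by rewrite at_ tb.
  by rewrite ler0_norm ?subr_le0 // opprB ltrBlDr -ltrBlDl.
have [bc|cb'] := leP b c; first by have <- : c = b by apply/eqP; rewrite eq_le cb bc.
pose s := Num.min b (c + e / 2).
have cs : c < s by rewrite lt_min cb' ltrDl divr_gt0.
have sb : s <= b by rewrite ge_min lexx.
have se : s <= c + e / 2 by rewrite ge_min lexx orbT.
have Pas : P a s.
  apply: (trP a c s) => //; first exact: ltW.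
  have as_ : a <= s by lra.
  apply: (proj2 (h s _ _)); rewrite ?as_ ?sb ?(ltW cs) //.
  by rewrite gtr0_norm ?subr_gt0 //; lra.
have : s <= c by apply: ub_le_sup; [exists b|split => //; apply/andP; split; lra].
by rewrite leNgt cs.
Qed.

Lemma tanh_lip s t : `|tanh s - tanh t| <= `|s - t|.
Proof.
wlog st : s t / t <= s.
  by move=> h; have [/h //|/ltW /h] := leP t s; rewrite distrC [leRHS]distrC.
rewrite !ger0_norm ?subr_ge0 //; last first.
  by move: st; rewrite le_eqVlt => /predU1P[->|/ltr_tanh /ltW].
have [||c _ ->] := @MVT_segment R (@tanh R) (fun x => 1 - tanh x ^+ 2) t s st.
- by move=> x _; exact: is_derive_tanh.
- apply: derivable_within_continuous => x _.
  by have [] := @is_derive_tanh R x.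
- by rewrite ler_piMl ?subr_ge0 // lerBlDr lerDl sqr_ge0.
Qed.

End IntervalInduction.

Section VectorLipschitz.
Context {R : realType} {d : nat}.
Local Notation V := 'rV[R[i]]_d.
Implicit Types (f : R[i] -> V).

Lemma normc_coord (M : V) i j : normc (M i j) <= vnorm M.
Proof.
rewrite -lecR -vnormE -normE -[leRHS]/(mx_norm M) mx_normE.
by rewrite -[leLHS]nngE num_le; apply: (le_bigmax _ _ (i, j)).
Qed.

Lemma vnorm_le_coord (M : V) (e : R) : 0 <= e -> (forall i j, normc (M i j) <= e) ->
  vnorm M <= e.
Proof.
move=> e0 h; rewrite -lecR -vnormE -[leLHS]/(mx_norm M).
have [->|/mx_norm_neq0 [[i j] ->]] := eqVneq (mx_norm M) 0; first by rewrite ler0c.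
by rewrite normE lecR; exact: h.
Qed.

Lemma has_cderiv_coord f z (c : V) i j : has_cderiv f z c ->
  has_cderiv (fun u => f u i j) z (c i j).
Proof.
move=> df e e0; have [r r0 hr] := df e e0; exists r => // h /hr.
apply: le_trans; rewrite vnorm_normc.
have -> : f (z + h) i j - f z i j - h *: c i j = (f (z + h) - f z - h *: c) i j.
  by rewrite !mxE.
exact: normc_coord.
Qed.

Lemma holomorphic_disc_lipschitz (D : set V) f (s : R) : holomorphic_disc D f ->
  0 <= s -> exists2 L : R, 0 <= L & forall t u, 0 <= t <= s -> 0 <= u <= s ->
    vnorm (f (tanh t)%:C - f (tanh u)%:C) <= L * `|t - u|.
Proof.
move=> hf s0.
have lipj j : exists L : R, 0 <= L /\ forall a b : R, 0 <= a <= tanh s -> 0 <= b <= tanh s ->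
    normc (f a%:C ord0 j - f b%:C ord0 j) <= L * `|a - b|.
  have df z : normc z < 1 -> derivable (fun u => f u ord0 j) z 1.
    move=> /hf [dz _].
    exact: (has_cderiv_derivable (has_cderiv_coord ord0 j (derivable_has_cderiv dz))).
  by have [L L0 hL] := holomorphic_lipschitz (tanh_ge0 s0) (tanh_lt1 s) df; exists L.
have [L hL] := choice lipj.
exists (\sum_j L j); first by apply: sumr_ge0 => j _; exact: (hL j).1.
move=> t u ht hu.
have S0 : 0 <= \sum_j L j by apply: sumr_ge0 => j _; exact: (hL j).1.
apply: vnorm_le_coord => [|i j]; first by rewrite mulr_ge0.
have thin v : 0 <= v <= s -> 0 <= tanh v <= tanh s.
  move=> /andP[v0 vs]; rewrite tanh_ge0 //=.
  by move: vs; rewrite le_eqVlt => /predU1P[->//|/ltr_tanh /ltW].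
have Lj : L j <= \sum_j L j.
  by rewrite (bigD1 j) //= lerDl; apply: sumr_ge0 => k _; exact: (hL k).1.
rewrite (ord1 i) !mxE.
apply: (le_trans ((hL j).2 _ _ (thin _ ht) (thin _ hu))).
by apply: ler_pM => //; [exact: (hL j).1|exact: tanh_lip].
Qed.

End VectorLipschitz.

Section DiscPath.
Context {R : realType} {d : nat}.
Local Notation V := 'rV[R[i]]_d.
Implicit Types (D : set V) (x y z w : V) (g : R -> V) (s t u T S : R).
Local Notation kd := kobayashi_distance.

(** The disc may depend on [s]: at a junction of two geodesics the past and
    the future of [g t] lie on different discs. *)
Definition disc_linked D T g := forall t, 0 <= t <= T ->
  exists2 eta : R, 0 < eta & forall s, 0 <= s <= T -> `|s - t| < eta ->
    disc_link D (g t) (g s) (s - t).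

Definition lipschitz_path T g := exists2 L : R, 0 <= L &
  forall s t, 0 <= s <= T -> 0 <= t <= T -> vnorm (g s - g t) <= L * `|s - t|.

(** Away from finitely many times the same disc serves on both sides, so that
    the path has a velocity there. *)
Definition piecewise_disc D T g := exists F : seq R, forall t, 0 < t < T ->
  t \notin F -> exists2 eta : R, 0 < eta & exists2 f, holomorphic_disc D f &
    forall h, `|h| < eta -> g (t + h) = f (tanh h)%:C.

Definition disc_path D T g :=
  [/\ 0 <= T, disc_linked D T g, lipschitz_path T g & piecewise_disc D T g].

Lemma segment_path D f T : holomorphic_disc D f -> 0 <= T ->
  disc_path D T (fun t => f (tanh t)%:C).
Proof.
move=> hf T0; split=> //.
- by move=> t _; exists 1 => // s _ _; exact: disc_link_segment.
- exact: holomorphic_disc_lipschitz hf T0.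
- exists [::] => t _ _; exists 1 => //.
  exists (fun a => f (moebius (tanh t)%:C a)).
    by apply: holomorphic_disc_moebius => //; exact: normc_tanh.
  by move=> h _; rewrite moebius_tanh.
Qed.

Definition path_cat S g1 g2 t : V := if t <= S then g1 t else g2 (t - S).

Lemma path_cat_l S g1 g2 t : t <= S -> path_cat S g1 g2 t = g1 t.
Proof. by rewrite /path_cat => ->. Qed.

Lemma path_cat_r S g1 g2 t : g1 S = g2 0 -> S <= t -> path_cat S g1 g2 t = g2 (t - S).
Proof.
move=> g12; rewrite /path_cat le_eqVlt => /predU1P[<-|St].
  by rewrite lexx subrr.
by rewrite leNgt St.
Qed.

Lemma disc_path_cat D S T g1 g2 : disc_path D S g1 -> disc_path D T g2 ->
  g1 S = g2 0 -> disc_path D (S + T) (path_cat S g1 g2).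
Proof.
move=> [S0 l1 [L1 L10 p1] [F1 s1]] [T0 l2 [L2 L20 p2] [F2 s2]] g12.
have L t := @path_cat_l S g1 g2 t; have Rr t := @path_cat_r S g1 g2 t g12.
have in1 t : 0 <= t -> t <= S -> 0 <= t <= S by move=> -> ->.
have in2 t : S <= t -> t <= S + T -> 0 <= t - S <= T.
  by move=> ? ?; apply/andP; split; lra.
split; first exact: addr_ge0.
- move=> t /andP[t0 tT].
  have [e1 e10 h1] : exists2 e : R, 0 < e & forall s, 0 <= s <= S -> `|s - t| < e ->
      disc_link D (path_cat S g1 g2 t) (g1 s) (s - t).
    have [tS|St] := leP t S; last first.
      exists (t - S); first by rewrite subr_gt0.
      move=> s /andP[_ sS]; rewrite ltr_norml => /andP[h _]; lra.
    have [e e0 h] := l1 t (in1 _ t0 tS).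
    by exists e => // s hs st; rewrite L //; exact: h.
  have [e2 e20 h2] : exists2 e : R, 0 < e & forall s, S <= s <= S + T -> `|s - t| < e ->
      disc_link D (path_cat S g1 g2 t) (g2 (s - S)) (s - t).
    have [St|tS] := leP S t; last first.
      exists (S - t); first by rewrite subr_gt0.
      move=> s /andP[sS _]; rewrite ltr_norml => /andP[_ h]; lra.
    have [e e0 h] := l2 _ (in2 _ St tT).
    exists e => // s /andP[hs1 hs2] st; rewrite Rr //.
    have -> : s - t = (s - S) - (t - S) by ring.
    apply: h; first exact: in2.
    by have -> : s - S - (t - S) = s - t by ring.
  exists (Num.min e1 e2); first by rewrite lt_min e10.
  move=> s /andP[s0 sT]; rewrite lt_min => /andP[se1 se2].
  have [sS|Ss] := leP s S.
    by rewrite [path_cat _ _ _ s]L //; apply: h1 => //; rewrite s0.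
  rewrite [path_cat _ _ _ s]Rr ?(ltW Ss) //; apply: h2 => //.
  by rewrite (ltW Ss).
- exists (L1 + L2); first exact: addr_ge0.
  suff lip s t : 0 <= s -> s <= t -> t <= S + T ->
      vnorm (path_cat S g1 g2 s - path_cat S g1 g2 t) <= (L1 + L2) * (t - s).
    move=> s t /andP[s0 sT] /andP[t0 tT].
    have [st|/ltW ts] := leP s t.
      by rewrite distrC ger0_norm ?subr_ge0 //; exact: lip.
    by rewrite vnormBC ger0_norm ?subr_ge0 //; exact: lip.
  move=> s0 st tT.
  have [tS|St] := leP t S.
    rewrite !L //; last by lra.
    apply: (le_trans (p1 _ _ (in1 s _ _) (in1 t _ _))); try lra.
    by rewrite distrC ger0_norm ?subr_ge0 // ler_wpM2r ?subr_ge0 // lerDl.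
  have St' := ltW St; have [Ss|sS] := leP S s.
    rewrite !Rr //.
    apply: (le_trans (p2 _ _ (in2 s _ _) (in2 t _ _))); try lra.
    have -> : s - S - (t - S) = s - t by ring.
    by rewrite distrC ger0_norm ?subr_ge0 // ler_wpM2r ?subr_ge0 // lerDr.
  rewrite L ?(ltW sS) // Rr //.
  have -> : g1 s - g2 (t - S) = (g1 s - g1 S) + (g2 0 - g2 (t - S)).
    by rewrite g12 addrA subrK.
  apply: (le_trans (vnormD _ _)).
  have h1 : vnorm (g1 s - g1 S) <= L1 * (S - s).
    have := p1 s S (in1 s _ _) (in1 S _ _); rewrite distrC ger0_norm; last lra.
    by apply; lra.
  have h2 : vnorm (g2 0 - g2 (t - S)) <= L2 * (t - S).
    have := p2 0 (t - S) _ (in2 t _ _); rewrite sub0r normrN ger0_norm; last lra.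
    by apply; rewrite ?lexx //; lra.
  apply: (le_trans (lerD h1 h2)).
  have := mulr_ge0 L10 (ltW (_ : 0 < t - S)); have := mulr_ge0 L20 (ltW (_ : 0 < S - s)).
  rewrite !subr_gt0 => /(_ sS) a1 /(_ St) a2; lra.
- exists (S :: (F1 ++ [seq S + t | t <- F2])) => t /andP[t0 tT].
  rewrite inE mem_cat !negb_or => /and3P[tS tF1 tF2].
  have [ltS|Slt] := ltP t S.
    have [|e e0 [f hf he]] := s1 t _ tF1; first by rewrite t0.
    exists (Num.min e (S - t)); first by rewrite lt_min e0 subr_gt0.
    exists f => // h; rewrite lt_min => /andP[h1 h2].
    by rewrite L ?he //; move: h2; rewrite ltr_norml => /andP[_ h2]; lra.
  have {}Slt : S < t by rewrite lt_neqAle Slt eq_sym tS.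
  have [||e e0 [f hf he]] := s2 (t - S).
  - by apply/andP; split; lra.
  - by apply: contra tF2 => tF; apply/mapP; exists (t - S); rewrite // addrC subrK.
  exists (Num.min e (t - S)); first by rewrite lt_min e0 subr_gt0.
  exists f => // h; rewrite lt_min => /andP[h1 h2].
  have hS : S <= t + h by move: h2; rewrite ltr_norml => /andP[h2 _]; lra.
  by rewrite Rr // -he // addrAC.
Qed.

Lemma disc_link_path D x y s : 0 <= s -> disc_link D x y s ->
  exists g, [/\ disc_path D s g, g 0 = x & g s = y].
Proof.
move=> s0 [f [hf <- <-]]; exists (fun t => f (tanh t)%:C).
by rewrite tanh0; split=> //; exact: segment_path.
Qed.

(** Running successively along the geodesics of the discs of a chain gives a
    path whose time parameter is the length of the chain. *)
Lemma disc_chain_path D x y s : disc_chain D x y s ->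
  exists g, [/\ disc_path D s g, g 0 = x & g s = y].
Proof.
move=> [n [f [a [b [+ <- <- + ->]]]]].
elim: n => [|n IHn] hf hab.
  have [hf0 ha hb] := hf 0%N (leqnn _); rewrite big_ord1.
  by apply: disc_link_path; [exact: poincare_ge0|exact: poincare_disc_link].
have [|j jn|g [hg g0 gs]] := IHn; first by move=> j jn; apply: hf; rewrite ltnW.
  by apply: hab; rewrite ltnW.
have [hfn ha hb] := hf n.+1 (leqnn _).
have [g' [hg' g'0 g's]] := disc_link_path (poincare_ge0 ha hb) (poincare_disc_link hfn ha hb).
rewrite big_ord_recr /=; set S := \sum_(_ < _) _ in gs hg *.
set T := poincare_distance _ _ in g's hg' *.
have g12 : g S = g' 0 by rewrite gs g'0; exact: hab.
have S0 : 0 <= S by case: hg.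
have T0 : 0 <= T by case: hg'.
exists (path_cat S g g'); split.
- exact: disc_path_cat.
- by rewrite path_cat_l.
- by rewrite path_cat_r ?lerDl // [S + T]addrC addrK.
Qed.

Lemma kd_lt_path D x y (r : \bar R) : (kd D x y < r)%E ->
  exists2 T, (T%:E < r)%E & exists g, [/\ disc_path D T g, g 0 = x & g T = y].
Proof. by move=> /kd_lt_chain[T /disc_chain_path hT Tr]; exists T. Qed.

Lemma disc_link_in D x y s : disc_link D x y s -> D x.
Proof.
move=> [f [hf <- _]]; apply: (hf 0 _).2.
by rewrite -[unit_disc _]/(is_true (normc 0 < 1)) Normc.normc0.
Qed.

Lemma disc_linked_in D T g t : disc_linked D T g -> 0 <= t <= T -> D (g t).
Proof.
move=> hg ht; have [e e0 h] := hg t ht.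
by apply: disc_link_in (h t ht _); rewrite subrr normr0.
Qed.

Lemma disc_linked_kd D T g s t : disc_linked D T g -> 0 <= s <= T -> 0 <= t <= T ->
  (kd D (g s) (g t) <= `|t - s|%:E)%E.
Proof.
move=> hg; wlog st : s t / s <= t.
  move=> h hs ht; have [/h|/ltW /h] := leP s t; first exact.
  by rewrite kd_sym distrC; exact.
move=> /andP[s0 sT] /andP[t0 tT]; rewrite ger0_norm ?subr_ge0 //.
pose P u v := (kd D (g u) (g v) <= (v - u)%:E)%E.
apply: (@interval_chaining _ P) => //.
  move=> u v w _ uv vw _ h1 h2; apply: (le_trans (kd_triangle _ _ (g v) _)).
  apply: (le_trans (leeD h1 h2)).
  by rewrite -EFinD lee_fin; lra.
move=> u /andP[su ut]; have [|e e0 he] := hg u; first by apply/andP; split; lra.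
exists e => // v /andP[sv vt] vu.
have hv : 0 <= v <= T by apply/andP; split; lra.
have := kd_link (he v hv vu).
split=> h; rewrite /P.
  by rewrite kd_sym -(ger0_norm (_ : 0 <= u - v)) ?subr_ge0 // distrC.
by rewrite -(ger0_norm (_ : 0 <= v - u)) ?subr_ge0.
Qed.

End DiscPath.

(** * Localization along a path *)

Section Localization.
Context {R : realType} {d : nat}.
Local Notation V := 'rV[R[i]]_d.
Implicit Types (Omega U : set V) (x y : V) (g : R -> V) (h r s t u T c : R).
Local Notation kd := kobayashi_distance.

(** If every point of [Omega] outside [U] is at distance at least [r] from the
    centre [x] of a disc in [Omega], then the concentric disc of hyperbolic
    radius [r] lands in [U], because discs decrease distances. Rescaling it to
    a full disc multiplies Euclidean radii by [(tanh r)^-1]. *)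
Lemma kd_localize_link Omega U x y h r : disc_link Omega x y h -> `|h| < r ->
  (forall y', (Omega `\` U) y' -> (r%:E <= kd Omega x y')%E) ->
  (kd (U `&` Omega) x y <= (artanh (tanh `|h| / tanh r))%:E)%E.
Proof.
move=> hl hr far.
have {hl} : disc_link Omega x y `|h|.
  by case: (ler0P h) => h0; [exact: disc_link_opp|exact: hl].
move: (normr_ge0 h) hr; move: `|h| => {}h h0 hr [f [hf f0 fh]].
have r0 : 0 < r by exact: le_lt_trans hr.
have tau0 := tanh_gt0 r0.
have tau1 : normc (tanh r)%:C <= 1 by exact/ltW/normc_tanh.
have hG : holomorphic_disc (U `&` Omega) (fun a => f ((tanh r)%:C * a)).
  move=> a ha; have [dG OG] := holomorphic_disc_scale hf tau1 ha.
  split=> //; split=> //; apply: contrapT => nU.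
  have o1 : normc (0 : R[i]) < 1 by rewrite Normc.normc0.
  have := far _ (conj OG nU); rewrite leNgt => /negP; apply.
  have n1 : normc ((tanh r)%:C * a) = tanh r * normc a.
    by rewrite Normc.normcM normc_real ger0_norm // ltW.
  have n2 : tanh r * normc a < tanh r by rewrite gtr_pMr.
  have n3 : tanh r * normc a < 1 by apply: (lt_trans n2); exact: tanh_lt1.
  rewrite -f0; apply: (le_lt_trans (kd_le_poincare hf o1 _)); first by rewrite n1.
  rewrite poincare0 n1 lte_fin -[ltRHS](artanh_tanh r); apply: ltr_artanh => //.
    by apply: (lt_le_trans (ltrN10 _)); rewrite mulr_ge0 ?normc_ge0 // ltW.
  exact: tanh_lt1.
have x0 : 0 <= tanh h / tanh r by rewrite divr_ge0 ?tanh_ge0 // ltW.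
have x1 : tanh h / tanh r < 1 by rewrite ltr_pdivrMr // mul1r; exact: ltr_tanh.
have o1 : normc (0 : R[i]) < 1 by rewrite Normc.normc0.
have nx : normc (tanh h / tanh r)%:C = tanh h / tanh r by rewrite normc_real ger0_norm.
have := @kd_le_poincare _ _ _ _ 0 (tanh h / tanh r)%:C hG o1; rewrite nx => /(_ x1).
rewrite poincare0 nx mulr0 f0 -rmorphM /= mulrCA mulfV ?mulr1 ?gt_eqF //.
by rewrite fh.
Qed.

(** To first order [artanh (tanh h / tau)] is [h / tau], so any [k > tau^-1]
    is admissible for small [h]; the condition on [k] says how small. *)
Lemma artanh_ratio_le h tau k : 0 <= h -> 0 < tau -> 1 <= (tau - h) * k -> 0 < k ->
  artanh (tanh h / tau) <= k * h.
Proof.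
move=> h0 tau0 htk k0.
have hth : tanh h <= h.
  by have := tanh_lip h 0; rewrite tanh0 !subr0 !ger0_norm // tanh_ge0.
have th0' := tanh_ge0 h0.
have ht : h < tau.
  rewrite -subr_gt0 -(pmulr_lgt0 _ k0); lra.
have x1 : tanh h / tau < 1 by rewrite ltr_pdivrMr //; lra.
apply: (le_trans (artanh_le _ x1)); first by rewrite divr_ge0 // ltW.
have -> : tanh h / tau / (1 - tanh h / tau) = tanh h / (tau - tanh h).
  by field; rewrite !gt_eqF //; lra.
rewrite ler_pdivrMr; last lra.
have : h * 1 <= h * ((tau - h) * k) by exact: ler_wpM2l.
have : 0 <= k * h * (h - tanh h) by rewrite !mulr_ge0 ?(ltW k0) //; lra.
nra.
Qed.

Lemma derivative_lower_bound (E : R -> R) t e' k : is_derive t 1 E e' -> k < e' ->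
  exists2 eta : R, 0 < eta & forall s, `|s - t| < eta ->
    (t <= s -> k * (s - t) <= E s - E t) /\ (s <= t -> k * (t - s) <= E t - E s).
Proof.
move=> [dE E'] ke.
have e0 : 0 < e' - k by rewrite subr_gt0.
have : (fun h => h^-1 *: (E (h *: 1 + t) - E t)) @ 0^' --> e'.
  by rewrite -E'; exact: dE.
move/cvgrPdist_lt/(_ _ e0)/nbhs_ballP => [eta /= eta0 h].
exists eta => // s st.
have [->|nst] := eqVneq s t; first by rewrite !subrr !mulr0.
have n0 : s - t != 0 by rewrite subr_eq0.
have := h (s - t); rewrite /ball /= sub0r normrN => /(_ st n0).
have -> : (s - t) *: 1 + t = s by rewrite [_ *: 1]mulr1 subrK.
set q := (s - t)^-1 * (E s - E t); rewrite -[_ *: _]/q => hq.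
have kq : k <= q.
  by move: hq; rewrite ltr_norml => /andP[_]; lra.
have qE : E s - E t = q * (s - t) by rewrite /q mulrC mulrA mulfV // mul1r.
split=> st'.
  by rewrite qE ler_wpM2r // subr_ge0.
have -> : E t - E s = q * (t - s) by rewrite -opprB qE -mulrN opprB.
by rewrite ler_wpM2r // subr_ge0.
Qed.

(** Amplitude of the correction in [kd_localize_path]; see [coth_lt], which
    dictates its value. *)
Definition localization_slope (delta c : R) : R :=
  2 * expR (2 * c) / (1 - expR (- (2 * delta))) + 1.

Lemma localization_slope_gt0 delta c : 0 < delta -> 0 < localization_slope delta c.
Proof.
move=> d0; rewrite /localization_slope ltr_wpDl //.
apply: divr_ge0; first by rewrite mulr_ge0 // expR_ge0.
by rewrite subr_ge0 -expR0 ler_expR oppr_le0 mulr_ge0 // ltW.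
Qed.

(** As [coth r - 1 = 2 / (expR (2 * r) - 1)] decays like [expR (- 2 * r)], it
    is dominated by a multiple of the derivative of [tanh] once [r] grows at
    unit speed in [u]. *)
Lemma coth_lt delta c u r : 0 < delta -> delta <= r -> `|u| - c <= r ->
  (tanh r)^-1 < 1 + localization_slope delta c * (1 - tanh u ^+ 2).
Proof.
move=> d0 dr ur; have r0 : 0 < r by lra.
apply: (@lt_le_trans _ _ (1 + localization_slope delta c * expR (- (2 * `|u|)))); last first.
  rewrite lerD2l ler_wpM2l ?tanh_sech //; exact/ltW/localization_slope_gt0.
rewrite /localization_slope; set a := expR (- (2 * delta)).
have a1 : a < 1 by rewrite -expR0 ltr_expR oppr_lt0 mulr_gt0.
pose e := expR (2 * r).
have e1 : 1 < e by rewrite -expR0 ltr_expR mulr_gt0.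
have -> : (tanh r)^-1 = 1 + 2 / (e - 1).
  by rewrite tanhE -/e; field; rewrite !gt_eqF //; lra.
rewrite ltrD2l.
apply: (@le_lt_trans _ _ (2 * expR (2 * c) / (1 - a) * expR (- (2 * `|u|)))); last first.
  by rewrite [ltRHS]mulrDl mul1r ltrDl expR_gt0.
have ae : 1 <= a * e.
  by rewrite /a /e -expRD -[leLHS]expR0 ler_expR; lra.
have ue : expR (2 * `|u|) <= e * expR (2 * c).
  by rewrite /e -expRD ler_expR; lra.
rewrite expRN.
have p0 := expR_gt0 (2 * `|u|); have q0 := expR_gt0 (2 * c).
move: (expR (2 * `|u|)) (expR (2 * c)) p0 q0 ue => p q p0 q0 ue.
have -> : 2 * q / (1 - a) / p = (2 * q) / ((1 - a) * p).
  by field; rewrite !gt_eqF //; lra.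
rewrite ler_pdivrMr; last lra.
rewrite mulrAC ler_pdivlMr; last by apply: mulr_gt0 => //; lra.
have a1' : 0 < 1 - a by lra.
have : (1 - a) * p <= (1 - a) * (e * q) by rewrite ler_pM2l.
have : 0 <= q * (a * e - 1) by apply: mulr_ge0; lra.
nra.
Qed.

(** Passing from [Omega] to [U `&` Omega] multiplies the speed of the path at
    time [t] by at most [coth r], with [r] the distance of [g t] to the
    complement of [U]. If [r] grows linearly as [t] moves away from some time
    [t0], then [coth r - 1] decays exponentially, and its integral over the
    whole path is bounded independently of the length. Here [E t = t + M *
    tanh (t - t0)] majorizes the length, and the inequality is propagated by
    [interval_chaining]. *)
Lemma kd_localize_path Omega U T g (delta t0 c : R) :
  0 <= T -> disc_linked Omega T g -> 0 < delta ->
  (forall t y, 0 <= t <= T -> (Omega `\` U) y ->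
     ((Num.max delta (`|t - t0| - c))%:E <= kd Omega (g t) y)%E) ->
  (kd (U `&` Omega) (g 0%R) (g T)
     <= (T + 2 * localization_slope delta c)%:E)%E.
Proof.
move=> T0 hg d0 far.
pose M := localization_slope delta c.
have M0 : 0 < M by exact: localization_slope_gt0.
pose E t : R := t + M * tanh (t - t0).
pose P u v := (kd (U `&` Omega) (g u) (g v) <= (E v - E u)%:E)%E.
suff : P 0 T.
  move/le_trans; apply; rewrite lee_fin /E -/M.
  have := tanh_lt1 (T - t0); have := tanh_gtN1 (0 - t0); nra.
apply: (@interval_chaining _ P) => //.
  move=> u v w _ _ _ _ h1 h2; apply: (le_trans (kd_triangle _ _ (g v) _)).
  by apply: (le_trans (leeD h1 h2)); rewrite -EFinD lee_fin; lra.
move=> t ht; pose r := Num.max delta (`|t - t0| - c).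
have dr : delta <= r by rewrite le_max lexx.
have ur : `|t - t0| - c <= r by rewrite le_max lexx orbT.
have r0 : 0 < r by lra.
have tau0 := tanh_gt0 r0; have taur := coth_lt d0 dr ur.
pose e' := 1 + M * (1 - tanh (t - t0) ^+ 2).
have dE : is_derive t 1 E e'.
  have dsh : is_derive t 1 (fun s : R => tanh (s - t0)) (1 - tanh (t - t0) ^+ 2).
    have ds : is_derive t 1 (fun s : R => s - t0) 1.
      by apply: is_derive_eq; rewrite subr0.
    have := @is_derive1_comp R tanh (fun s : R => s - t0) t _ _ (@is_derive_tanh R (t - t0)) ds.
    by rewrite mulr1.
  rewrite (_ : E = id + M \*: (fun s : R => tanh (s - t0))); last by apply/funext.
  by apply: is_derive_eq.
(* a rate strictly between the speed in [U `&` Omega] and that of [E], which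
   leaves room for the second order terms *)
pose k := ((tanh r)^-1 + e') / 2.
have k1 : (tanh r)^-1 < k by rewrite /k; move: taur; rewrite -/e'; lra.
have k2 : k < e' by rewrite /k; move: taur; rewrite -/e'; lra.
have k0 : 0 < k by apply: lt_trans k1; rewrite invr_gt0.
have [e1 e10 h1] := derivative_lower_bound dE k2.
have [e2 e20 h2] := hg t ht.
pose e3 := tanh r - k^-1.
have e30 : 0 < e3.
  by rewrite subr_gt0 -[ltRHS]invrK ltf_pV2 ?posrE ?invr_gt0.
exists (Num.min (Num.min e1 e2) (Num.min e3 r)).
  by rewrite !lt_min e10 e20 e30 r0.
move=> s hs; rewrite !lt_min => /andP[/andP[s1 s2] /andP[s3 s4]].
have := kd_localize_link (h2 s hs s2) s4 (far t ^~ ht).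
have ratio : artanh (tanh `|s - t| / tanh r) <= k * `|s - t|.
  apply: artanh_ratio_le => //.
  rewrite -ler_pdivrMr // mul1r; move: s3; rewrite /e3; lra.
move=> hk; have {hk} hk := le_trans hk (_ : _ <= (k * `|s - t|)%:E)%E.
have [g1 g2] := h1 s s1.
split=> st; rewrite /P.
  rewrite kd_sym; apply: (le_trans (hk _)); rewrite lee_fin //.
  by rewrite ler0_norm ?subr_le0 // opprB; exact: g2.
apply: (le_trans (hk _)); rewrite lee_fin //.
by rewrite ger0_norm ?subr_ge0 //; exact: g1.
Qed.

End Localization.

(** * Almost-optimal paths are almost-geodesics *)

Section AlmostGeodesic.
Context {R : realType} {d : nat}.
Local Notation V := 'rV[R[i]]_d.
Implicit Types (D : set V) (x y v : V) (g : R -> V) (h r s t u T c kappa : R).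
Local Notation kd := kobayashi_distance.

Lemma lipschitz_abs_continuous T g : lipschitz_path T g ->
  abs_continuous `[0, T] g.
Proof.
move=> [L L0 hL] e e0; exists (e / (L + 1)); first by rewrite divr_gt0 // ltr_wpDl.
move=> n a b hab _ hsum.
have le1 j : vnorm (g (b j) - g (a j)) <= L * (b j - a j).
  have [ab aI bI] := hab j; rewrite !in_itv /= in aI bI.
  by have := hL _ _ bI aI; rewrite ger0_norm ?subr_ge0.
have -> : \sum_(j < n) `|g (b j) - g (a j)| = (\sum_(j < n) vnorm (g (b j) - g (a j)))%:C.
  by rewrite rmorph_sum /=; apply: eq_bigr => j _; rewrite vnormE.
rewrite ltcR; apply: (@le_lt_trans _ _ (\sum_(j < n) L * (b j - a j))).
  by apply: ler_sum => j _.
have S0 : 0 <= \sum_(j < n) (b j - a j).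
  by apply: sumr_ge0 => j _; have [ab _ _] := hab j; rewrite subr_ge0.
rewrite -mulr_sumr; apply: (@le_lt_trans _ _ ((L + 1) * \sum_(j < n) (b j - a j))).
  by rewrite ler_wpM2r // lerDl.
by rewrite mulrC -ltr_pdivlMr // ltr_wpDl.
Qed.

Lemma tanh_close_id e : 0 < e -> exists2 eta : R, 0 < eta &
  forall h, `|h| < eta -> `|tanh h - h| <= e * `|h|.
Proof.
move=> e0; have e1 : 1 - e < 1 - tanh 0 ^+ 2 :> R by rewrite tanh0 expr0n /= subr0; lra.
have [eta eta0 hE] := derivative_lower_bound (is_derive_tanh 0) e1.
exists eta => // h; rewrite -{1}[h]subr0 => /hE [h1 h2].
rewrite tanh0 !subr0 !sub0r in h1 h2.
have := tanh_lip h 0; rewrite tanh0 !subr0.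
have [h0|h0] := leP 0 h.
  rewrite (ger0_norm h0) (ger0_norm (tanh_ge0 h0)) => h3; have {}h1 := h1 h0.
  by rewrite ler_norml; apply/andP; split; nra.
have th0' : tanh h <= 0 by rewrite -oppr_ge0 -tanhN tanh_ge0 // oppr_ge0 ltW.
rewrite (ltr0_norm h0) (ler0_norm th0') => h3; have {}h2 := h2 (ltW h0).
by rewrite ler_norml; apply/andP; split; nra.
Qed.

(** Since [tanh] has derivative 1 at 0, the velocity of the path is the
    derivative of the disc at its centre. *)
Lemma disc_velocity D g t eta f : 0 < eta -> holomorphic_disc D f ->
  (forall h, `|h| < eta -> g (t + h) = f (tanh h)%:C) ->
  has_velocity g t ('D_1 f 0).
Proof.
move=> eta0 hf gf.
have o1 : unit_disc (0 : R[i]).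
  by rewrite -[unit_disc _]/(is_true (normc 0 < 1)) Normc.normc0.
have df := derivable_has_cderiv (hf 0 o1).1.
set v := 'D_1 f 0 in df *.
have gt : g t = f 0.
  by have := gf 0; rewrite normr0 addr0 tanh0 => ->.
apply/cvg_vnormP => e e0.
have v0 := vnorm_ge0 v.
pose e1 := e / 3; pose e2 := e / (3 * (1 + vnorm v)).
have e10 : 0 < e1 by rewrite divr_gt0.
have e20 : 0 < e2 by rewrite divr_gt0 // mulr_gt0 // ltr_pwDl.
have [r1 r10 h1] := df _ e10; have [r2 r20 h2] := tanh_close_id e20.
apply/nbhs_ballP; exists (Num.min eta (Num.min r1 r2)).
  by rewrite /= !lt_min eta0 r10 r20.
move=> h; rewrite /ball /= sub0r normrN !lt_min => /andP[k0 /andP[k1 k2]] hn0.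
have thh : `|tanh h| <= `|h| by have := tanh_lip h 0; rewrite tanh0 !subr0.
have nh : 0 < `|h| by rewrite normr_gt0.
rewrite gf // gt; set k := (tanh h)%:C.
have := h1 k; rewrite normc_real add0r => /(_ (le_lt_trans thh k1)) a1.
have -> : v - (h^-1)%:C *: (f k - f 0) =
   - ((h^-1)%:C *: ((f k - f 0 - k *: v) + (tanh h - h)%:C *: v)).
  have -> : f k - f 0 - k *: v + (tanh h - h)%:C *: v = f k - f 0 - h%:C *: v.
    by rewrite rmorphB /= scalerBl addrA subrK.
  by rewrite [in RHS]scalerBr scalerA -rmorphM /= mulVf // scale1r opprB.
rewrite vnormN vnormZ normc_real normfV mulrC ltr_pdivrMr //.
apply: (le_lt_trans (vnormD _ _)); rewrite vnormZ normc_real.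
have a2 : `|tanh h - h| * vnorm v <= e / 3 * `|h|.
  apply: (@le_trans _ _ (e2 * `|h| * (1 + vnorm v))).
    by apply: ler_pM => //; [exact: h2|rewrite lerDr].
  rewrite le_eqVlt; apply/orP; left; apply/eqP; rewrite /e2; field.
  by rewrite gt_eqF //; lra.
have a3 : e1 * `|tanh h| <= e / 3 * `|h| by rewrite ler_pM2l.
have : 0 < e * `|h| by exact: mulr_gt0.
lra.
Qed.

Lemma disc_metric_le1 D f : holomorphic_disc D f ->
  (kobayashi_metric D (f 0%R) ('D_1%R f 0%R) <= 1)%E.
Proof.
move=> hf; apply: ereal_inf_lbound; exists 1; last by rewrite Normc.normc1.
by exists f; split=> //; rewrite scale1r.
Qed.

(** The speed bound is built in, as each velocity comes from a disc with
    scaling factor 1. A path whose length is within [kappa] of the distance of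
    its endpoints cannot waste more than [kappa] on any of its parts, by the
    triangle inequality. *)
Lemma disc_path_almost_geodesic D T g kappa : 0 <= kappa -> disc_path D T g ->
  (T%:E <= kd D (g 0%R) (g T) + kappa%:E)%E ->
  almost_geodesic kappa D `[0, T] g.
Proof.
move=> k0 [T0 hl hL [F hF]] hT.
have inT (t : R) : t \in `[0, T] -> 0 <= t <= T by rewrite in_itv.
split.
- by move=> t /inT; exact: disc_linked_in hl.
- exact: lipschitz_abs_continuous.
- have main s t : 0 <= s -> s <= t -> t <= T ->
     ((`|t - s| - kappa)%:E <= kd D (g s) (g t))%E.
    move=> s0 st tT.
    have r0 : 0 <= (0 : R) <= T by apply/andP; split.
    have rs : 0 <= s <= T by apply/andP; split; lra.
    have rt : 0 <= t <= T by apply/andP; split; lra.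
    have rT : 0 <= T <= T by apply/andP; split.
    have := disc_linked_kd hl r0 rs; rewrite subr0 (ger0_norm s0) => a1.
    have := disc_linked_kd hl rt rT; rewrite (ger0_norm (_ : 0 <= T - t)) ?subr_ge0 // => a2.
    rewrite ger0_norm ?subr_ge0 //.
    have [->|hfin] := eqVneq (kd D (g s) (g t)) +oo%E; first by rewrite leey.
    have ff : kd D (g s) (g t) \is a fin_num.
      by rewrite ge0_fin_numE ?kd_ge0 // lt_neqAle hfin leey.
    rewrite -(fineK ff) lee_fin.
    have : (T%:E <= s%:E + ((fine (kd D (g s) (g t)))%:E + (T - t)%:E) + kappa%:E)%E.
      apply: (le_trans hT); apply: leeD => //.
      apply: (le_trans (kd_triangle _ _ (g s) _)); apply: leeD => //.
      by apply: (le_trans (kd_triangle _ _ (g t) _)); apply: leeD => //; rewrite fineK.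
    by rewrite -!EFinD lee_fin; lra.
  move=> s t /inT /andP[s0 sT] /inT /andP[t0 tT]; split.
    have [st|/ltW ts] := leP s t; first exact: main.
    by rewrite distrC kd_sym; exact: main.
  apply: (le_trans (disc_linked_kd hl _ _)); rewrite ?s0 ?sT ?t0 ?tT //.
  by rewrite lee_fin lerDl.
- have cF : countable [set` 0 :: T :: F].
    exact: (finite_set_countable (finite_seq _)).
  have N0 : lebesgue_measure.-negligible [set` 0 :: T :: F].
    exists [set` 0 :: T :: F]; split=> //.
    + by apply: countable_measurable cF => t; exact: measurable_set1.
    + exact: countable_lebesgue_measure0.
  apply: negligibleS N0 => t /=.
  apply: contra_notP => /negP; rewrite !inE !negb_or => /and3P[t0 tT tF] /inT /andP[u0 uT].
  have [|e e0 [f hf gf]] := hF t _ tF.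
    by rewrite !lt_neqAle eq_sym t0 u0 tT uT.
  exists ('D_1 f 0); first exact: (disc_velocity e0 hf gf).
  have -> : g t = f 0 by have := gf 0; rewrite normr0 addr0 tanh0 => ->.
  exact: disc_metric_le1.
Qed.

End AlmostGeodesic.

(** * Consequences of visibility *)

Section LocalBounds.
Context {R : realType} {d : nat}.
Local Notation V := 'rV[R[i]]_d.
Implicit Types (D K A B : set V) (o p q x y z : V) (g : R -> V) (r s t C : R).
Local Notation kd := kobayashi_distance.

(** Affine discs inside a ball. *)
Lemma kd_locally_bounded D p : open D -> D p ->
  exists2 C, 0 <= C & \forall x \near p, D x /\ (kd D p x <= C%:E)%E.
Proof.
move=> oD Dp; have : nbhs p D by exact: open_nbhs_nbhs.
move=> /nbhs_vnormP [r r0 hr].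
exists (artanh 2^-1); first by apply: artanh_ge0; lra.
apply/nbhs_vnormP; exists (r / 2); first by rewrite divr_gt0.
move=> x px.
have Dx : D x by apply: hr; lra.
split=> //; pose f (a : R[i]) := p + a *: (2 *: (x - p)).
have hf : holomorphic_disc D f.
  move=> a ha; split.
    apply: (@has_cderiv_derivable R V f a (2 *: (x - p))) => e e0.
    exists 1 => // h _; rewrite /f scalerDl opprD addrACA subrr add0r.
    rewrite [a *: _ + _ - _]addrAC subrr add0r subrr.
    by rewrite /vnorm normr0 /= mulr_ge0 ?normc_ge0 // ltW.
  apply: hr; rewrite /f opprD addNKr vnormN !vnormZ.
  have -> : normc (2 : R[i]) = 2.
    by have := normc_real (2 : R); rewrite rmorph_nat => ->; rewrite ger0_norm.
  rewrite (vnormBC x).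
  have := normc_ge0 a; have := vnorm_ge0 (p - x).
  rewrite /unit_disc /= in ha; move: (normc a) (vnorm (p - x)) ha px.
  move=> u v u1 vr v0 u0; nra.
have n2 : normc ((2^-1 : R)%:C) = 2^-1 by rewrite normc_real ger0_norm.
have o1 : normc (0 : R[i]) < 1 by rewrite Normc.normc0.
have := @kd_le_poincare _ _ _ _ 0 (2^-1 : R)%:C hf o1; rewrite n2 poincare0 n2.
have -> : f 0 = p by rewrite /f scale0r addr0.
have -> : f (2^-1 : R)%:C = x.
  rewrite /f scalerA.
  have -> : (2^-1 : R)%:C * 2 = 1 :> R[i].
    by rewrite -(rmorph_nat (real_complex R)) -rmorphM /= mulVf.
  by rewrite scale1r addrC subrK.
by apply; lra.
Qed.

(** The points at finite distance from [o] form a subset of [D] that is open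
    and closed in [D]. *)
Lemma kd_finite D o x : open D -> connected D -> D o -> D x -> (kd D o x < +oo)%E.
Proof.
move=> oD cD Do Dx.
pose B := [set x | D x /\ (kd D o x < +oo)%E].
suff : B = D by move=> BD; have : B x by [rewrite BD]; case.
apply: cD.
- exists o; split=> //; have [C C0 h] := kd_locally_bounded oD Do.
  have [_ hC] := nbhs_singleton h.
  exact: le_lt_trans hC (ltry _).
- exists B; last by apply/seteqP; split=> y; [move=> By; split => //; case: By|case].
  rewrite openE => y [Dy yfin]; have [C C0 h] := kd_locally_bounded oD Dy.
  apply: filterS h => w [Dw hw]; split=> //.
  apply: (le_lt_trans (kd_triangle _ _ y _)).
  by apply: lte_add_pinfty => //; exact: le_lt_trans hw (ltry _).
- exists (~` (D `\` B)).
    apply: open_closedC; rewrite openE => y [Dy nB].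
    have [C C0 h] := kd_locally_bounded oD Dy.
    apply: filterS h => w [Dw hw]; split=> // -[_ wfin]; apply: nB; split=> //.
    apply: (le_lt_trans (kd_triangle _ _ w _)).
    apply: lte_add_pinfty => //; rewrite kd_sym; exact: le_lt_trans hw (ltry _).
  apply/seteqP; split=> y; first by move=> [Dy yf]; split=> // -[_]; apply.
  by move=> [Dy nn]; apply: contrapT => nB; apply: nn.
Qed.

Lemma kd_bounded_near D o p : open D -> connected D -> D o -> D p ->
  exists2 C, 0 <= C & \forall x \near p, D x /\ (kd D x o <= C%:E)%E.
Proof.
move=> oD cD Do Dp; have [C C0 h] := kd_locally_bounded oD Dp.
have f : kd D p o \is a fin_num by rewrite ge0_fin_numE ?kd_ge0 // kd_finite.
exists (C + fine (kd D p o)); first by rewrite addr_ge0 // fine_ge0 // kd_ge0.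
apply: filterS h => x [Dx hx]; split=> //.
apply: (le_trans (kd_triangle _ _ p _)); rewrite EFinD fineK //.
by apply: leeD => //; rewrite kd_sym.
Qed.

Lemma kd_bounded_compact D K o : open D -> connected D -> D o -> compact K ->
  K `<=` D -> exists2 C, 0 <= C & forall x, K x -> (kd D x o <= C%:E)%E.
Proof.
move=> oD cD Do /compact_near_coveringP cK KD.
have cov x : K x -> \forall x' \near x & C \near +oo, (kd D x' o <= C%:E)%E.
  move=> /KD Dx; have [C C0 h] := kd_bounded_near oD cD Do Dx.
  exists ([set x' | D x' /\ (kd D x' o <= C%:E)%E], [set C' : R | C <= C']).
    by split=> //=; exact: (nbhs_pinfty_ge (num_real _)).
  move=> [x' C'] [/= [_ h1] h2]; apply: (le_trans h1); by rewrite lee_fin.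
have hn := cK R (pinfty_nbhs R) (fun C x => (kd D x o <= C%:E)%E) _ cov.
have [C [hC C0]] : exists C : R, K `<=` (fun x => (kd D x o <= C%:E)%E) /\ 0 <= C.
  near (pinfty_nbhs R) => C; exists C; split; near: C.
    exact: hn.
  exact: (nbhs_pinfty_ge (num_real _)).
by exists C.
Unshelve. all: by end_near. Qed.

End LocalBounds.

Section VisibilityBound.
Context {R : realType} {d : nat}.
Local Notation V := 'rV[R[i]]_d.
Implicit Types (D K A B Omega U : set V) (o p q x y z : V) (g : R -> V) (r s t C : R).
Local Notation kd := kobayashi_distance.

Lemma not_closure_near A p : ~ closure A p -> \forall x \near p, ~ A x.
Proof.
move=> nc; have oC : open (~` closure A) by apply: closed_openC; exact: closed_closure.
have : nbhs p (~` closure A) by apply: open_nbhs_nbhs.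
by apply: filterS => x nx Ax; apply: nx; exact: subset_closure.
Qed.

(** An almost-optimal path from near [p] to near [q] is an almost-geodesic, so
    it meets the compact set provided by visibility; going from [z] to [o]
    through that meeting point costs no more than the whole path plus a
    constant. *)
Lemma visibility_pair_bound D p q o : open D -> connected D -> D o ->
  weak_visibility D p q ->
  exists2 C, 0 <= C & (exists2 N, nbhs p N & exists2 M, nbhs q M &
    forall z y, N z -> M y -> D z -> D y -> (kd D z o <= kd D z y + C%:E)%E).
Proof.
move=> oD cD Do /(_ 1 ler01) [Vp [Vq [K [[nVp nVq] _ [cK KD] vis]]]].
have [C C0 hC] := kd_bounded_compact oD cD Do cK KD.
exists (C + 1); first by rewrite addr_ge0.
exists Vp => //; exists Vq => // z y Vz Vy Dz Dy.
have [->|hfin] := eqVneq (kd D z y) +oo%E; first by rewrite addye // leey.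
have ff : kd D z y \is a fin_num.
  by rewrite ge0_fin_numE ?kd_ge0 // lt_neqAle hfin leey.
have [T hT [g [hg g0 gT]]] : exists2 T, (T%:E < (fine (kd D z y) + 1)%:E)%E &
    exists g, [/\ disc_path D T g, g 0 = z & g T = y].
  by apply: kd_lt_path; rewrite EFinD fineK // lteDl // lte_fin.
have T0 : 0 <= T by case: hg.
rewrite lte_fin in hT.
have ag : almost_geodesic 1 D `[0, T] g.
  apply: disc_path_almost_geodesic => //; rewrite g0 gT -(fineK ff) -EFinD lee_fin.
  exact: ltW.
have [|| w [[t]]] := vis T g T0 ag; rewrite ?g0 ?gT //.
rewrite /= in_itv /= => /andP[t0 tT] <- Kg.
apply: (le_trans (kd_triangle _ _ (g t) _)).
have r0 : 0 <= (0 : R) <= T by apply/andP; split.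
have rt : 0 <= t <= T by apply/andP; split.
have hl : disc_linked D T g by case: hg.
have := disc_linked_kd hl r0 rt; rewrite subr0 (ger0_norm t0) g0 => h1.
apply: (le_trans (leeD h1 (hC _ Kg))).
by rewrite -(fineK ff) -!EFinD lee_fin; lra.
Qed.

(** Compactness of [A `*` B] reduces the claim to neighbourhoods of pairs [(p,
    q)]. If [p] or [q] lies in [Omega] the distances to [o] are locally
    bounded; if one of them is outside the closure there is nothing to prove;
    otherwise both are boundary points, distinct as [A] and [B] are disjoint,
    and visibility applies. *)
Lemma visibility_bound Omega U A B o :
  open Omega -> open U -> connected (U `&` Omega) -> (U `&` Omega) o ->
  (forall p q, (U `&` frontier Omega) p -> (U `&` frontier Omega) q -> p <> q ->
     weak_visibility (U `&` Omega) p q) ->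
  compact A -> compact B -> A `<=` U -> B `<=` U -> A `&` B = set0 ->
  exists2 C, 0 <= C & forall z y, (A `&` Omega) z -> (B `&` Omega) y ->
    (kd (U `&` Omega) z o <= kd (U `&` Omega) z y + C%:E)%E.
Proof.
move=> oO oU; set D := U `&` Omega => cD Do vis cA cB AU BU AB.
have oD : open D by exact: openI.
pose Q C (zy : V * V) := D zy.1 -> D zy.2 ->
  (kd D zy.1 o <= kd D zy.1 zy.2 + C%:E)%E.
have /compact_near_coveringP cAB := compact_setX cA cB.
have nT (x : V) : nbhs x [set: V].
  by apply/nbhs_vnormP; exists 1.
have loc p q : A p -> B q -> exists2 C, 0 <= C & (exists2 N, nbhs p N &
    exists2 M, nbhs q M & forall z y, N z -> M y -> Q C (z, y)).
  move=> Ap Bq.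
  have [cp|ncp] := pselect (closure Omega p); last first.
    exists 0; first exact: lexx.
    exists (fun x => ~ Omega x); first exact: not_closure_near.
    exists [set: V]; first exact: nT.
    by move=> z y nO _ [_ /= Oz]; exfalso; exact: nO.
  have [cq|ncq] := pselect (closure Omega q); last first.
    exists 0; first exact: lexx.
    exists [set: V]; first exact: nT.
    exists (fun x => ~ Omega x); first exact: not_closure_near.
    by move=> z y _ nO _ [_ /= Oz]; exfalso; exact: nO.
  have [Op|nOp] := pselect (Omega p).
    have [C C0 h] := kd_bounded_near oD cD Do (conj (AU _ Ap) Op : D p).
    exists C; first exact: C0.
    eexists; first exact: h.
    exists [set: V]; first exact: nT.
    move=> z y [_ hz] _ _ _ /=; apply: (le_trans hz).
    by rewrite leeDr // kd_ge0.
  have [Oq|nOq] := pselect (Omega q).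
    have [C C0 h] := kd_bounded_near oD cD Do (conj (BU _ Bq) Oq : D q).
    exists C; first exact: C0.
    exists [set: V]; first exact: nT.
    eexists; first exact: h.
    move=> z y _ [_ hy] _ _ /=; apply: (le_trans (kd_triangle _ _ y _)).
    exact: leeD.
  have fp : (U `&` frontier Omega) p.
    by split; [exact: AU|split=> // /interior_subset].
  have fq : (U `&` frontier Omega) q.
    by split; [exact: BU|split=> // /interior_subset].
  have pq : p <> q.
    by move=> E; have : (A `&` B) p by [split=> //; rewrite E]; rewrite AB.
  have [C C0 [N hN [M hM h]]] := visibility_pair_bound oD cD Do (vis p q fp fq pq).
  exists C; first exact: C0.
  exists N; first exact: hN.
  by exists M; [exact: hM|move=> z y Nz My Dz Dy; exact: h].
have cov zy : (A `*` B) zy -> \forall x' \near zy & C \near +oo, Q C x'.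
  case: zy => p q [/= Ap Bq]; have [C C0 [N hN [M hM h]]] := loc p q Ap Bq.
  exists (N `*` M, [set C' : R | C <= C']).
    by split=> /=; [exists (N, M)|exact: (nbhs_pinfty_ge (num_real _))].
  move=> [[z y] C'] [/= [Nz My] CC'] Dz Dy.
  apply: (le_trans (h z y Nz My Dz Dy)) => /=.
  by apply: leeD => //; rewrite lee_fin.
have hn := cAB R (pinfty_nbhs R) Q _ cov.
have [C [hC C0]] : exists C : R, A `*` B `<=` Q C /\ 0 <= C.
  near (pinfty_nbhs R) => C; exists C; split; near: C.
    exact: hn.
  exact: (nbhs_pinfty_ge (num_real _)).
exists C => // z y [Az Oz] [By Oy].
apply: (hC (z, y)) => //; split=> //=; [exact: AU|exact: BU].
Unshelve. all: by end_near. Qed.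

End VisibilityBound.

(** * Shrinking neighbourhoods and exit times *)

Section Topology.
Context {R : realType} {d : nat}.
Local Notation V := 'rV[R[i]]_d.
Implicit Types (K W : set V) (x y z : V) (g : R -> V) (r s t T C : R).

Lemma closure_vnormP W x : closure W x <->
  forall e : R, 0 < e -> exists2 y, W y & vnorm (x - y) < e.
Proof.
split=> [cx e e0|h].
  have [|y [Wy xy]] := cx (fun y => vnorm (x - y) < e); last by exists y.
  by apply/nbhs_vnormP; exists e.
by move=> B /nbhs_vnormP[e e0 hB]; have [y Wy xy] := h e e0; exists y; split=> //; exact: hB.
Qed.

Lemma compact_open_shrink K W : compact K -> open W -> K `<=` W ->
  exists W1, [/\ open W1, K `<=` W1 & closure W1 `<=` W].
Proof.
move=> /compact_near_coveringP cK oW KW.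
pose P C x := forall y, vnorm (x - y) * C < 1 -> W y.
have cov x : K x -> \forall x' \near x & C \near +oo, P C x'.
  move=> /KW Wx; have : nbhs x W by apply: open_nbhs_nbhs.
  move=> /nbhs_vnormP[r r0 hr].
  exists ([set x' | vnorm (x - x') < r / 2], [set C : R | 2 / r <= C]).
    split => /=; last exact: (nbhs_pinfty_ge (num_real _)).
    by apply/nbhs_vnormP; exists (r / 2); rewrite ?divr_gt0.
  move=> [x' C] [/= h1 h2] y h3; apply: hr.
  have -> : x - y = (x - x') + (x' - y) by rewrite addrA subrK.
  apply: (le_lt_trans (vnormD _ _)).
  have rC : 2 <= C * r by rewrite -ler_pdivrMr.
  have C0 : 0 < C by apply: lt_le_trans h2; rewrite divr_gt0.
  have v0 := vnorm_ge0 (x' - y).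
  have : vnorm (x' - y) < r / 2.
    rewrite -(ltr_pM2r C0); apply: (lt_le_trans h3).
    rewrite mulrAC ler_pdivlMr //; lra.
  lra.
have hn := cK R (pinfty_nbhs R) P _ cov.
have [C [hC C0]] : exists C : R, K `<=` P C /\ 1 <= C.
  near (pinfty_nbhs R) => C; exists C; split; near: C.
    exact: hn.
  exact: (nbhs_pinfty_ge (num_real _)).
have C0' : 0 < C by lra.
pose eta := (2 * C)^-1.
have eta0 : 0 < eta by rewrite invr_gt0 mulr_gt0.
exists [set y | exists2 x, K x & vnorm (x - y) < eta]; split.
- rewrite openE => y [x Kx xy]; apply/nbhs_vnormP.
  exists (eta - vnorm (x - y)); first by rewrite subr_gt0.
  move=> u yu; exists x => //.
  have -> : x - u = (x - y) + (y - u) by rewrite addrA subrK.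
  by apply: (le_lt_trans (vnormD _ _)); lra.
- by move=> x Kx; exists x => //; rewrite subrr /vnorm normr0.
- move=> y /closure_vnormP /(_ _ eta0) [u [x Kx xu] yu].
  apply: (hC x Kx y).
  have : vnorm (x - y) < 2 * eta.
    have -> : x - y = (x - u) + (u - y) by rewrite addrA subrK.
    by apply: (le_lt_trans (vnormD _ _)); rewrite (vnormBC u); lra.
  rewrite -(ltr_pM2r C0') /eta => h; apply: (lt_le_trans h).
  by rewrite le_eqVlt; apply/orP; left; apply/eqP; field; rewrite gt_eqF.
Unshelve. all: by end_near. Qed.

(** Continuity of the path, in the form of a Lipschitz bound, makes the first
    exit time an infimum that is attained. *)
Lemma first_exit T g W : 0 <= T -> lipschitz_path T g -> open W -> W (g 0) ->
  ~ W (g T) -> exists t1, [/\ 0 < t1 <= T,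
    forall t, 0 <= t < t1 -> W (g t), ~ W (g t1) & closure W (g t1)].
Proof.
move=> T0 [L L0 hL] oW W0 WT.
pose S := [set t | 0 <= t <= T /\ ~ W (g t)].
have ST : S T by split=> //; rewrite T0 lexx.
have lbS : lbound S 0 by move=> t [/andP[]].
have hi : has_inf S by split; [exists T|exists 0].
pose t1 := inf S.
have t10 : 0 <= t1 by apply: lb_le_inf => //; exists T.
have t1T : t1 <= T by apply: ge_inf => //; exists 0.
have before t : 0 <= t -> t < t1 -> W (g t).
  move=> t0 tt; apply: contrapT => nW.
  have : t1 <= t.
    by apply: ge_inf; [exists 0|split=> //; rewrite t0 /= (ltW (lt_le_trans tt t1T))].
  by rewrite leNgt tt.
have in1 : 0 <= t1 <= T by rewrite t10 t1T.
have L10 : 0 < L + 1 by rewrite ltr_wpDl.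
have near1 e : 0 < e -> forall t, 0 <= t <= T -> `|t1 - t| < e / (L + 1) ->
    vnorm (g t1 - g t) < e.
  move=> e0 t ht h; apply: (le_lt_trans (hL _ _ in1 ht)).
  apply: (@le_lt_trans _ _ ((L + 1) * `|t1 - t|)); first by rewrite ler_wpM2r // lerDl.
  by rewrite mulrC -ltr_pdivlMr.
have nW1 : ~ W (g t1).
  move=> W1; have : nbhs (g t1) W by apply: open_nbhs_nbhs.
  move=> /nbhs_vnormP[e e0 he].
  have e'0 : 0 < e / (L + 1) by rewrite divr_gt0.
  have [t [ht nWt] tt] := inf_adherent e'0 hi.
  have t1t : t1 <= t by apply: ge_inf; [exists 0|split].
  apply: nWt; apply: he; apply: near1 => //.
  have tt' : t < t1 + e / (L + 1) by exact: tt.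
  rewrite ltr_norml; apply/andP; split; lra.
have t1gt : 0 < t1.
  rewrite lt_neqAle t10 andbT; apply/eqP => E; apply: nW1; by rewrite -E.
exists t1; split=> //; first by rewrite t1gt.
  by move=> t /andP[]; exact: before.
apply/closure_vnormP => e e0.
have e'0 : 0 < e / (L + 1) by rewrite divr_gt0.
pose t := Num.max 0 (t1 - e / (L + 1) / 2).
have tt : t < t1 by rewrite gt_max t1gt /= ltrBlDr ltrDl divr_gt0.
have t0 : 0 <= t by rewrite le_max lexx.
exists (g t); first exact: before.
apply: near1 => //; first by rewrite t0 (ltW (lt_le_trans tt t1T)).
rewrite gtr0_norm ?subr_gt0 //.
have : t1 - e / (L + 1) / 2 <= t by rewrite le_max lexx orbT.
lra.
Qed.

End Topology.

(** * Comparison of the two distances *)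

Section ExitEstimate.
Context {R : realType} {d : nat}.
Local Notation V := 'rV[R[i]]_d.
Implicit Types (Omega U W A : set V) (o x y z : V) (g : R -> V) (r s t T C : R).
Local Notation kd := kobayashi_distance.

Lemma sub_disc_linked Omega T T' g : T' <= T -> disc_linked Omega T g ->
  disc_linked Omega T' g.
Proof.
move=> TT hg t /andP[t0 tT]; have [|e e0 h] := hg t; first by apply/andP; split; lra.
by exists e => // s /andP[s0 sT]; apply: h; apply/andP; split; lra.
Qed.

(** Let [m] be the distance in [Omega] from [z] to [Omega `\` W], and follow a
    path of length less than [m + 1] towards [Omega `\` W] until it first
    leaves [W]. Being almost optimal, at time [t] it is still at distance at
    least [m - t] from the complement of [W], hence of [U]. So
    [kd_localize_path] with [t0 = m] shows that the exit point is at [U `&`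
    Omega]-distance at most [m] plus a constant, and [visibility_bound]
    compares this distance with the one to [o]. *)
Lemma kd_exit_bound Omega U W A o (delta : R) :
  open Omega -> open U -> connected (U `&` Omega) -> (U `&` Omega) o ->
  (forall p q, (U `&` frontier Omega) p -> (U `&` frontier Omega) q -> p <> q ->
     weak_visibility (U `&` Omega) p q) ->
  (forall x y, Omega x -> Omega y -> kd Omega x y \is a fin_num) ->
  open W -> compact (closure W) -> closure W `<=` U -> compact A -> A `<=` W ->
  0 < delta ->
  (forall x y, (W `&` Omega) x -> (Omega `\` U) y -> (delta%:E <= kd Omega x y)%E) ->
  exists2 C, 0 <= C & forall z y, (A `&` Omega) z -> (Omega `\` W) y ->
    (kd (U `&` Omega) z o <= kd Omega z y + C%:E)%E.
Proof.
move=> oO oU cD Do vis fin oW cW WU cA AW d0 far.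
have WU' : W `<=` U by move=> x Wx; apply: WU; exact: subset_closure.
pose B := closure W `&` ~` W.
have cB : compact B.
  by apply: compact_closedI => //; exact: open_closedC.
have [CV CV0 hV] : exists2 C, 0 <= C & forall z y, (A `&` Omega) z -> (B `&` Omega) y ->
    (kd (U `&` Omega) z o <= kd (U `&` Omega) z y + C%:E)%E.
  apply: visibility_bound => //.
  - by move=> x /AW /WU'.
  - by move=> x [/WU].
  - by apply/seteqP; split=> x // [/AW Wx] [_]; apply.
(* the path below has length at most [m + 1], so that [m - t] is at least
   [|t - m| - 2] all along it *)
pose M := localization_slope delta 2.
have M0 : 0 < M by exact: localization_slope_gt0.
exists (1 + 2 * M + CV); first by have := ltW M0; lra.
move=> z y [Az Oz] [Oy nWy].
pose m := ereal_inf [set kd Omega z y' | y' in Omega `\` W].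
have my : (m <= kd Omega z y)%E by apply: ereal_inf_lbound; exists y.
have m0 : (0 <= m)%E by apply: le_ereal_inf_tmp => _ [y' _ <-]; exact: kd_ge0.
have mfin : m \is a fin_num.
  rewrite ge0_fin_numE //; apply: (le_lt_trans my).
  by rewrite -ge0_fin_numE ?kd_ge0 // fin.
pose mr := fine m.
have mE : m = mr%:E by rewrite fineK.
have [_ [y1 [Oy1 nWy1] <-] ym] : exists2 a, [set kd Omega z y' | y' in Omega `\` W] a &
    (a < (mr + 1)%:E)%E.
  by apply: ereal_inf_lt; rewrite -/m mE lte_fin ltrDl.
have [T hT [g [[T0 hl hlip _] g0 gT]]] := kd_lt_path ym.
rewrite lte_fin in hT.
have [||t1 [/andP[t10 t1T] before nWt1 clt1]] := first_exit T0 hlip oW.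
- by rewrite g0; exact: AW.
- by rewrite gT.
have hl1 := sub_disc_linked t1T hl.
have r0 : 0 <= (0 : R) <= T by apply/andP; split.
have gO t : 0 <= t <= T -> Omega (g t) by exact: (disc_linked_in hl).
have rT t : 0 <= t <= t1 -> 0 <= t <= T by move=> /andP[? ?]; apply/andP; split; lra.
have rt1 : 0 <= t1 <= T by apply/andP; split=> //; exact: ltW.
have far1 t y' : 0 <= t <= t1 -> (Omega `\` U) y' ->
    ((Num.max delta (`|t - mr| - 2))%:E <= kd Omega (g t) y')%E.
  move=> ht [Oy' nUy']; have /andP[t0 tt1] := ht.
  have ff : kd Omega (g t) y' \is a fin_num by apply: fin => //; apply: gO; exact: rT.
  rewrite -(fineK ff) lee_fin ge_max; apply/andP; split.
    have [tlt|tge] := ltP t t1.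
      rewrite -lee_fin fineK //; apply: far => //; split; last exact/gO/rT.
      by apply: before; rewrite t0.
    (* the exit point lies outside [W], but is a limit of points of [W] *)
    have te : t = t1 by apply/eqP; rewrite eq_le tt1.
    apply/ler_addgt0Pr => e e0.
    pose t' := Num.max 0 (t1 - e).
    have t'1 : t' < t1 by rewrite gt_max t10 /= ltrBlDr ltrDl.
    have t'0 : 0 <= t' by rewrite le_max lexx.
    have rt' : 0 <= t' <= T by apply: rT; rewrite t'0 ltW.
    have et' : t1 - e <= t' by rewrite le_max lexx orbT.
    rewrite -lee_fin EFinD fineK //.
    have h1 : (delta%:E <= kd Omega (g t') y')%E.
      by apply: far => //; split; [apply: before; rewrite t'0|exact: gO].
    apply: (le_trans h1); apply: (le_trans (kd_triangle _ _ (g t) _)).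
    rewrite addeC; apply: leeD => //.
    apply: (le_trans (disc_linked_kd hl rt' (rT _ ht))).
    by rewrite lee_fin te ger0_norm; lra.
  have h1 : (m <= t%:E + kd Omega (g t) y')%E.
    apply: (@le_trans _ _ (kd Omega z y')).
      apply: ereal_inf_lbound; exists y' => //; split=> // /WU'; exact: nUy'.
    apply: (le_trans (kd_triangle _ _ (g t) _)); apply: leeD => //.
    by have := disc_linked_kd hl r0 (rT _ ht); rewrite subr0 (ger0_norm t0) g0.
  move: h1; rewrite mE -(fineK ff) -EFinD lee_fin /= => h1.
  by case: (ler0P (t - mr)) => ?; lra.
have hloc := kd_localize_path (ltW t10) hl1 d0 far1.
rewrite g0 -/M in hloc.
have hv : (B `&` Omega) (g t1) by split; [split|exact: gO].
apply: (le_trans (hV z _ (conj Az Oz) hv)).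
apply: (le_trans (leeD hloc (lexx _))).
apply: (@le_trans _ _ (m + (1 + 2 * M + CV)%:E)%E); last exact: leeD.
by rewrite mE -!EFinD lee_fin; lra.
Qed.

End ExitEstimate.

Unset Implicit Arguments.
Local Close Scope complex_scope.

Theorem theorem1p1 (R : realType) (d : nat) (d_ge1 : (1 <= d)%N)
    (Omega U : set 'rV[R[i]]_d)
    (Omega_domain : domain Omega)
    (Omega_hyperbolic : kobayashi_hyperbolic Omega)
    (U_open : open U)
    (U_meets_frontier : U `&` frontier Omega !=set0)
    (U_frontier_gt1 : (`I_2 #<= U `&` frontier Omega)%card)
    (U_Omega_connected : connected (U `&` Omega))
    (visibility : forall p q : 'rV[R[i]]_d,
      (U `&` frontier Omega) p -> (U `&` frontier Omega) q -> p <> q ->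
      weak_visibility (U `&` Omega) p q)
    (W W0 : set 'rV[R[i]]_d)
    (W_open : open W) (W0_open : open W0)
    (W_meets_Omega : W `&` Omega !=set0)
    (W_W0 : relatively_compact_in W W0)
    (W0_U : relatively_compact_in W0 U)
    (W0_far : (0 < set_distance (kobayashi_distance Omega)
                     (W0 `&` Omega) (Omega `\` U))%E) :
  exists2 C : R, 0 < C &
    forall z w : 'rV[R[i]]_d, (W `&` Omega) z -> (W `&` Omega) w ->
      (kobayashi_distance (U `&` Omega) z w
         <= kobayashi_distance Omega z w + C%:E)%E.
Proof.
have [oO _ _] := Omega_domain.
have [finO _ _ _] := Omega_hyperbolic.
have fin x y : Omega x -> Omega y -> kobayashi_distance Omega x y \is a fin_num.
  by move=> Ox Oy; have [] := finO x y Ox Oy.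
have [cW WW0] := W_W0; have [cW0 W0U] := W0_U.
have W0U' : W0 `<=` U by move=> x ?; apply: W0U; exact: subset_closure.
have := W_meets_Omega => -[] o [Wo Oo].
have Do : (U `&` Omega) o.
  by split=> //; apply: W0U'; apply: WW0; exact: subset_closure.
have [delta d0 far] : exists2 delta : R, 0 < delta &
    forall x y, (W0 `&` Omega) x -> (Omega `\` U) y ->
      (delta%:E <= kobayashi_distance Omega x y)%E.
  have lb x y : (W0 `&` Omega) x -> (Omega `\` U) y ->
      (set_distance (kobayashi_distance Omega) (W0 `&` Omega) (Omega `\` U)
        <= kobayashi_distance Omega x y)%E.
    by move=> hx hy; apply: ereal_inf_lbound; exists x => //; exists y.
  move: W0_far lb; set D := set_distance _ _ _.
  case: D => [r| |] // r0 lb; first by exists r.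
  by exists 1 => // x y hx hy; apply: le_trans (lb x y hx hy); rewrite leey.
have [W1 [oW1 WW1 W1W0]] := compact_open_shrink cW W0_open WW0.
have W1sub : W1 `<=` closure W1 by exact: subset_closure.
have cW1 : compact (closure W1).
  apply: (subclosed_compact _ cW0); first exact: closed_closure.
  by move=> x /W1W0; exact: subset_closure.
have [C1 C10 exit1] : exists2 C, 0 <= C & forall z y, (closure W `&` Omega) z ->
    (Omega `\` W1) y -> (kobayashi_distance (U `&` Omega) z o
      <= kobayashi_distance Omega z y + C%:E)%E.
  apply: (@kd_exit_bound _ _ Omega U W1 (closure W) o delta) => //.
    by move=> x /W1W0 /W0U'.
  by move=> x y [W1x Ox]; apply: far; split=> //; apply: W1W0; exact: W1sub.
have [C2 C20 exit2] : exists2 C, 0 <= C & forall z y, (closure W1 `&` Omega) z ->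
    (Omega `\` W0) y -> (kobayashi_distance (U `&` Omega) z o
      <= kobayashi_distance Omega z y + C%:E)%E.
  exact: (@kd_exit_bound _ _ Omega U W0 (closure W1) o delta).
(* [C2] is the loss in [exit2], and 1 the loss of optimality of the path *)
pose M := localization_slope delta (C2 + 1).
have M0 : 0 < M by exact: localization_slope_gt0.
exists (1 + 2 * M + 2 * C1); first by lra.
move=> z w [Wz Oz] [Ww Ow].
have kfin := fin z w Oz Ow.
have [T hT [g [[T0 hl _ _] g0 gT]]] : exists2 T, (T%:E <
    (fine (kobayashi_distance Omega z w) + 1)%:E)%E &
    exists g, [/\ disc_path Omega T g, g 0 = z & g T = w].
  by apply: kd_lt_path; rewrite EFinD fineK // lteDl // lte_fin.
rewrite lte_fin in hT.
have gO t : 0 <= t <= T -> Omega (g t) by exact: (disc_linked_in hl).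
have r0 : 0 <= (0 : R) <= T by apply/andP; split.
have rT : 0 <= T <= T by apply/andP; split.
have clW x : W x -> closure W x by exact: subset_closure.
rewrite -(fineK kfin) -EFinD.
have [stay|/existsNP[t /not_implyP[ht nW1]]] := pselect (forall t, 0 <= t <= T -> W1 (g t)).
- pose a := fine (kobayashi_distance Omega z o).
  have afin := fin z o Oz Oo.
  have far1 t y : 0 <= t <= T -> (Omega `\` U) y ->
     ((Num.max delta (`|t - a| - (C2 + 1)))%:E <= kobayashi_distance Omega (g t) y)%E.
    move=> ht [Oy nUy]; have /andP[t0 tT] := ht.
    have ff := fin _ _ (gO t ht) Oy; have fo := fin _ _ (gO t ht) Oo.
    rewrite -(fineK ff) lee_fin ge_max; apply/andP; split.
      rewrite -lee_fin fineK //; apply: far => //; split; last exact: gO.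
      by apply: W1W0; apply: W1sub; exact: stay.
    have h1 : (kobayashi_distance Omega (g t) o
        <= kobayashi_distance Omega (g t) y + C2%:E)%E.
      apply: (le_trans (kd_mono (D := U `&` Omega) _ _ _)); first by move=> x [].
      apply: exit2; first by split; [exact/W1sub/stay|exact: gO].
      by split=> // /W0U'; exact: nUy.
    have h2 : (kobayashi_distance Omega z o
        <= t%:E + kobayashi_distance Omega (g t) o)%E.
      apply: (le_trans (kd_triangle _ _ (g t) _)); apply: leeD => //.
      by have := disc_linked_kd hl r0 ht; rewrite subr0 (ger0_norm t0) g0.
    (* the detour through [o] cannot shorten an almost-optimal path by more
       than 1, so that [t - 1] is at most the sum of the distances to [o] *)
    have h3 : (kobayashi_distance Omega z w
        <= (kobayashi_distance Omega z o + kobayashi_distance Omega (g t) o) + (T - t)%:E)%E.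
      apply: (le_trans (kd_triangle _ _ (g t) _)); apply: leeD.
        by apply: (le_trans (kd_triangle _ _ o _)); rewrite (kd_sym _ o).
      have := disc_linked_kd hl ht rT; rewrite gT ger0_norm ?subr_ge0 //.
    move: h1 h2 h3; rewrite -(fineK ff) -(fineK fo) -(fineK afin) -(fineK kfin).
    rewrite -!EFinD !lee_fin -/a => h1 h2 h3.
    by case: (ler0P (t - a)) => ?; lra.
  have := kd_localize_path T0 hl d0 far1; rewrite g0 gT -/M => h.
  by apply: (le_trans h); rewrite lee_fin; lra.
- have /andP[t0 tT] := ht; have Ogt := gO t ht.
  have hz := exit1 z (g t) (conj (clW _ Wz) Oz) (conj Ogt nW1).
  have hw := exit1 w (g t) (conj (clW _ Ww) Ow) (conj Ogt nW1).
  have a1 := disc_linked_kd hl r0 ht; rewrite subr0 (ger0_norm t0) g0 in a1.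
  have a2 := disc_linked_kd hl ht rT; rewrite gT kd_sym ger0_norm ?subr_ge0 // in a2.
  apply: (le_trans (kd_triangle _ _ o _)); rewrite (kd_sym _ o w).
  apply: (le_trans (leeD hz hw)).
  apply: (le_trans (leeD (leeD a1 (lexx _)) (leeD a2 (lexx _)))).
  by rewrite -!EFinD lee_fin; lra.
Qed.
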